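(* Let $1<p,q<\infty$, $0<\alpha\le 1$, $0\le\beta<n$, $\alpha+\beta<n$, $m\in\mathbb Z^+$, $\frac1q=\frac1p-\frac{m\alpha+\beta}{n}$, and let $\omega\in A_{p,q}$. Let $\Omega$ be a real-valued measurable function on $\mathbb S^{n-1}$ (extended to $\mathbb R^n\setminus\{0\}$ as a homogeneous function of degree zero, and with mean value zero on $\mathbb S^{n-1}$ if $\beta=0$) for which there is an open subset of $\mathbb S^{n-1}$ on which $\Omega$ does not change sign and is not equivalent to zero. Let $b$ be a locally integrable function on $\mathbb R^n$, real-valued if $m\ge2$. If there is a constant $C>0$ such that for every bounded measurable set $E\subset\mathbb R^n$, $$\|(T_{\Omega,\beta})_b^m(\chi_E)\|_{L^q(\omega^q)}\le C\,(\omega^p(E))^{1/p},$$ then $b\in \mathrm{BMO}_\alpha(\mathbb R^n)$.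
   Context: Cubes $Q\subset\mathbb R^n$ are closed with sides parallel to the coordinate axes, and $f_Q:=\frac1{|Q|}\int_Q f$. Operators: $T_{\Omega,\beta}f(x):=\int_{\mathbb R^n}\frac{\Omega(x-y)}{|x-y|^{n-\beta}}f(y)\,dy$ (understood as usual in the principal value sense for the singular case $\beta=0$). For a linear operator $T$, $T_b^1f:=[b,T]f:=b\,T(f)-T(bf)$ and $T_b^mf:=[b,T_b^{m-1}]f$ for $m\ge 2$, for suitable $f$; thus $(T_{\Omega,\beta})_b^m f(x)=\int_{\mathbb R^n}(b(x)-b(y))^m\frac{\Omega(x-y)}{|x-y|^{n-\beta}}f(y)\,dy$. The hypothesis on $(T_{\Omega,\beta})_b^m(\chi_E)$ includes that these functions are well defined. Mean value zero means $\int_{\mathbb S^{n-1}}\Omega\,d\sigma=0$. $\mathrm{BMO}_\alpha(\mathbb R^n)$: all $f\in L^1_{loc}(\mathbb R^n)$ with $\|f\|_{\mathrm{BMO}_\alpha(\mathbb R^n)}:=\sup_Q \mathcal O_\alpha(f;Q)<\infty$, where $\mathcal O_\alpha(f;Q):=\frac{1}{|Q|^{1+\alpha/n}}\int_Q|f(x)-f_Q|\,dx$. $A_{p,q}$: for $1<p,q<\infty$ with $\frac1q=\frac1p-\frac sn$ for some $0<s<n$, a weight $\omega$ is in $A_{p,q}$ if $\sup_Q\left(\frac1{|Q|}\int_Q\omega^q\right)^{1/q}\left(\frac1{|Q|}\int_Q\omega^{-p'}\right)^{1/p'}<\infty$, $\frac1p+\frac1{p'}=1$. $\omega^p(E):=\int_E\omega(x)^p\,dx$,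 and $\|g\|_{L^q(\omega^q)}:=\left(\int_{\mathbb R^n}|g|^q\omega^q\,dx\right)^{1/q}$. *)

(* Defs.v *)
From HB Require Import structures.
From mathcomp Require Import all_boot all_order all_algebra.
From mathcomp Require Import complex.
From mathcomp Require Import all_classical all_reals all_analysis.
From mathcomp Require Import measurable_realfun.

Set Implicit Arguments.
Unset Strict Implicit.
Unset Printing Implicit Defensive.

Import Order.TTheory GRing.Theory Num.Theory.
Import numFieldNormedType.Exports.
Import Normc.

Local Open Scope classical_set_scope.
Local Open Scope ring_scope.

Definition rv_display : measure_display.
Proof. exact: default_measure_display. Qed.

Section rv_measurable.
Context {R : realType} (n : nat).

Definition rv_coord (i : 'I_n) (x : 'rV[R]_n) : measurableTypeR R := x ord0 i.

Let rv_set0 : g_sigma_preimage rv_coord set0.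
Proof. exact: sigma_algebra0. Qed.

Let rv_setC A : g_sigma_preimage rv_coord A -> g_sigma_preimage rv_coord (~` A).
Proof. exact: sigma_algebraC. Qed.

Let rv_bigcup (F : (set _)^nat) : (forall i, g_sigma_preimage rv_coord (F i)) ->
  g_sigma_preimage rv_coord (\bigcup_i (F i)).
Proof. exact: sigma_algebra_bigcup. Qed.

HB.instance Definition _ := @isMeasurable.Build rv_display
  'rV[R]_n (g_sigma_preimage rv_coord) rv_set0 rv_setC rv_bigcup.

Lemma measurable_rv_coord (i : 'I_n) : measurable_fun [set: 'rV[R]_n] (rv_coord i).
Proof.
move=> _ Y mY; rewrite setTI; apply: sub_sigma_algebra => /=.
rewrite -bigcup_seq/=; exists i => /=; first by rewrite mem_index_enum.
by exists Y => //; rewrite setTI.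
Qed.

Lemma measurable_fun_rvP d (T : measurableType d) (f : T -> 'rV[R]_n) :
  (forall i, measurable_fun [set: T] (fun x => f x ord0 i : measurableTypeR R)) ->
  measurable_fun [set: T] f.
Proof.
move=> mf.
have sub : g_sigma_preimage (fun i => rv_coord i \o f) `<=` measurable.
  apply: smallest_sub; first exact: sigma_algebra_measurable.
  rewrite -bigcup_seq/=; apply: bigcup_sub => i _.
  by move=> A [B mB <-]; exact: mf.
move: sub; rewrite g_sigma_preimage_comp => sub _ A mA.
by apply: sub; exists A.
Qed.

End rv_measurable.

Section lebesgue_step.
Local Open Scope ereal_scope.
Context {R : realType} (n : nat).
Variable mu : {sigma_finite_measure set 'rV[R]_n -> \bar R}.

Definition rv_cons (p : measurableTypeR R * 'rV[R]_n) : 'rV[R]_(1 + n) :=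
  row_mx (p.1)%:M p.2.

Definition lebesgue_cons (A : set 'rV[R]_(1 + n)) : \bar R :=
  (@lebesgue_measure R \x mu) (rv_cons @^-1` A).

Lemma measurable_rv_cons : measurable_fun setT rv_cons.
Proof.
apply: measurable_fun_rvP => i; case: (split_ordP i) => j ->.
- under eq_fun do rewrite /rv_cons row_mxEl (ord1 j) mxE eqxx mulr1n.
  exact: measurable_fst.
- under eq_fun do rewrite /rv_cons row_mxEr.
  apply: (measurableT_comp (measurable_rv_coord j)) => //.
Qed.

Let lc0 : lebesgue_cons set0 = 0.
Proof. by rewrite /lebesgue_cons preimage_set0 measure0. Qed.

Let lc_ge0 A : 0 <= lebesgue_cons A.
Proof. exact: measure_ge0. Qed.

Let mpre A : measurable A -> measurable (rv_cons @^-1` A).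
Proof.
by move=> mA; rewrite -[X in measurable X]setTI; exact: measurable_rv_cons.
Qed.

Let lc_sigma_additive : semi_sigma_additive lebesgue_cons.
Proof.
move=> F mF tF mUF; rewrite /lebesgue_cons preimage_bigcup.
apply: measure_semi_sigma_additive.
- by move=> k; exact: mpre.
- apply/trivIsetP => /= i j _ _ ij; rewrite -preimage_setI.
  by move/trivIsetP : tF => /(_ _ _ _ _ ij) ->//; rewrite preimage_set0.
- by rewrite -preimage_bigcup; exact: mpre.
Qed.

HB.instance Definition _ := isMeasure.Build _ _ _ lebesgue_cons
  lc0 lc_ge0 lc_sigma_additive.

Let lc_sigma_finite : sigma_finite setT lebesgue_cons.
Proof.
have /sigma_finiteP[F [TF ndF Foo]] := sigma_finiteT (@lebesgue_measure R).
have /sigma_finiteP[G [TG ndG Goo]] := sigma_finiteT mu.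
have UFGT : \bigcup_k (F k `*` G k) = setT.
  rewrite -setXTT TF TG predeqE => -[x y]; split.
    by move=> [k _ []/= ? ?]; split; exists k.
  move=> [/= [k _ Fkx] [l _ Gly]]; exists (maxn k l) => //; split.
  - by move: x Fkx; exact/subsetPset/ndF/leq_maxl.
  - by move: y Gly; exact/subsetPset/ndG/leq_maxr.
pose g (x : 'rV[R]_(1 + n)) : measurableTypeR R * 'rV[R]_n :=
  (x ord0 (lshift n ord0), rsubmx x).
have mg : measurable_fun setT g.
  apply: measurable_fun_pair => /=; first exact: measurable_rv_coord.
  apply: measurable_fun_rvP => i; under eq_fun do rewrite mxE.
  exact: measurable_rv_coord.
have gK p : g (rv_cons p) = p.
  case: p => a v; rewrite /g /rv_cons /= row_mxEl row_mxKr mxE eqxx mulr1n.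
  by [].
exists (fun k => g @^-1` (F k `*` G k)).
  by rewrite -preimage_bigcup UFGT.
move=> k; have [mFk Fk] := Foo k; have [mGk Gk] := Goo k; split.
  rewrite -[X in measurable X]setTI; apply: mg => //; exact: measurableX.
rewrite /lebesgue_cons -comp_preimage (_ : g \o rv_cons = idfun).
  by rewrite preimage_id product_measure1E// lte_mul_pinfty// ge0_fin_numE.
by apply/funext => p /=; rewrite gK.
Qed.

HB.instance Definition _ := Measure_isSigmaFinite.Build _ _ _ lebesgue_cons
  lc_sigma_finite.

End lebesgue_step.

Fixpoint borel_lebesgue (R : realType) (n : nat) :
    {sigma_finite_measure set 'rV[R]_n -> \bar R} :=
  match n with
  | 0 => \d_(0 : 'rV[R]_0)
  | k.+1 => lebesgue_cons (borel_lebesgue R k)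
  end.

Lemma borel_lebesgue_cube (R : realType) n (a : 'rV[R]_n) (l : R) : 0 <= l ->
  borel_lebesgue R n
    [set x | forall i, a ord0 i <= x ord0 i <= a ord0 i + l] = (l ^+ n)%:E.
Proof.
move=> l0; elim: n a => [|n IH] a.
  rewrite /= diracE mem_set// => -[].
  by [].
rewrite /= /lebesgue_cons (_ : _ @^-1` _ =
    `[a ord0 ord0, a ord0 ord0 + l]%classic `*`
    [set x : 'rV[R]_n | forall i, rsubmx (a : 'rV_(1 + n)) ord0 i <= x ord0 i
                           <= rsubmx (a : 'rV_(1 + n)) ord0 i + l]); last first.
  have l0E : lshift n (ord0 : 'I_1) = ord0 :> 'I_(1 + n) by apply/val_inj.
  apply/seteqP; split => -[t v] /=; rewrite /rv_cons /=.
    move=> h0; have h (i : 'I_(1 + n)) : (a : 'rV_(1 + n)) ord0 i <=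
        (row_mx t%:M v : 'rV_(1 + n)) ord0 i <= (a : 'rV_(1 + n)) ord0 i + l.
      exact: h0.
    split.
      by have := h (lshift n (ord0 : 'I_1)); rewrite row_mxEl mxE eqxx mulr1n in_itv/= l0E.
    by move=> i; have := h (@rshift 1 n i); rewrite row_mxEr mxE.
  move=> [ht hv] i0; suff : forall i : 'I_(1 + n), (a : 'rV_(1 + n)) ord0 i <=
      (row_mx t%:M v : 'rV_(1 + n)) ord0 i <= (a : 'rV_(1 + n)) ord0 i + l.
    exact.
  move=> i; case: (split_ordP i) => j ->.
    by rewrite row_mxEl (ord1 j) mxE eqxx mulr1n l0E; move: ht; rewrite in_itv.
  by rewrite row_mxEr; have := hv j; rewrite mxE.
rewrite product_measure1E//; last first.
  pose A i := rv_coord i @^-1` `[rsubmx (a : 'rV_(1 + n)) ord0 i,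
                            rsubmx (a : 'rV_(1 + n)) ord0 i + l]%classic.
  rewrite (_ : [set _ | _] = \bigcap_(i in [set: 'I_n]) A i).
    apply: fin_bigcap_measurable => // i _; rewrite /A -[X in measurable X]setTI.
    exact: measurable_rv_coord.
  apply/seteqP; split => [x h i _|x h i].
    by rewrite /A /= in_itv /= h.
  by have := h i Logic.I; rewrite /A /= in_itv.
have itvE : lebesgue_measure `[a ord0 ord0, a ord0 ord0 + l]%classic = l%:E.
  rewrite lebesgue_measure_itv/= lte_fin ltrDl.
  move: l0; rewrite le_eqVlt => /predU1P[<-|->]; first by rewrite ltxx.
  by rewrite -EFinB addrAC subrr add0r.
by rewrite IH exprS EFinM -itvE.
Qed.

(* [rvL R n] is R^n with its Lebesgue sigma-algebra: the Caratheodory-measurable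
   sets are the completion of the Borel ones. *)
Definition rvL (R : realType) (n : nat) :=
  caratheodory_type (mu_ext (borel_lebesgue R n)).

Definition lebesgue (R : realType) (n : nat) : set (rvL R n) -> \bar R :=
  @completed_measure_extension _ _ _ (borel_lebesgue R n).

Arguments lebesgue R n : clear implicits.

HB.instance Definition _ (R : realType) (n : nat) :=
  Measure.on (lebesgue R n).

Section sphere.
Context {R : realType} (n : nat).
Implicit Types x : 'rV[R]_n.

Definition enorm x : R := Num.sqrt (\sum_(i < n) x ord0 i ^+ 2).

Definition sphere : set 'rV[R]_n := [set x | enorm x = 1].

Lemma measurable_enorm : measurable_fun [set: 'rV[R]_n] enorm.
Proof.
apply: (measurableT_comp (f := @Num.sqrt R)
  (g := fun x => \sum_(i < n) x ord0 i ^+ 2)).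
  by apply: continuous_measurable_fun; exact: sqrt_continuous.
apply: measurable_sum => i; apply: measurable_funX.
exact: measurable_rv_coord.
Qed.

Definition cone (A : set 'rV[R]_n) : set 'rV[R]_n :=
  [set x | 0 < enorm x < 1 /\ A ((enorm x)^-1 *: x)].

(* [sigma(A) = n |{r theta : 0 < r < 1, theta in A}|], carried by the sphere. *)
Definition borel_surface (A : set 'rV[R]_n) : \bar R :=
  (n%:R%:E * borel_lebesgue R n (cone A))%E.

Let bs0 : borel_surface set0 = 0%E.
Proof.
by rewrite /borel_surface (_ : cone _ = set0) ?measure0 ?mule0// -subset0 => x [].
Qed.

Let bs_ge0 A : (0 <= borel_surface A)%E.
Proof. by rewrite mule_ge0// lee_fin. Qed.

Let measurable_cone A : measurable A -> measurable (cone A).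
Proof.
move=> mA.
have mE (a b : R) : measurable (enorm @^-1` `]a, b[).
  by rewrite -[X in measurable X]setTI; exact: measurable_enorm.
rewrite (_ : cone A = (enorm @^-1` `]0, 1[) `&`
  ((fun x => (enorm x)^-1 *: x) @^-1` A)); last first.
  by apply/seteqP; split => x /=; rewrite in_itv/=.
have mN : measurable_fun setT (fun x : 'rV[R]_n => (enorm x)^-1 *: x).
  apply: measurable_fun_rvP => i; under eq_fun do rewrite mxE.
  apply: measurable_funM; last exact: measurable_rv_coord.
  under eq_fun do rewrite -powR_inv1 ?sqrtr_ge0//.
  exact: (measurableT_comp (measurable_powR (-1)) measurable_enorm).
by apply: measurableI; [exact: mE|rewrite -[X in measurable X]setTI; exact: mN].
Qed.

Let bs_sigma_additive : semi_sigma_additive borel_surface.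
Proof.
move=> F mF tF mUF.
rewrite /borel_surface (_ : cone (\bigcup_k F k) = \bigcup_k cone (F k)); last first.
  apply/seteqP; split => x /=.
    by move=> [x1 [k _ Fx]]; exists k.
  by move=> [k _ [x1 Fx]]; split => //; exists k.
rewrite [X in X @ _ --> _](_ : _ = fun k => (n%:R%:E *
    \sum_(0 <= i < k) borel_lebesgue R n (cone (F i)))%E); last first.
  by apply/funext => k; rewrite ge0_sume_distrr.
apply: cvgeZl => //; apply: measure_semi_sigma_additive.
- by move=> k; exact: measurable_cone.
- apply/trivIsetP => /= i j _ _ ij; rewrite -subset0 => x [[_ Fi] [_ Fj]].
  move/trivIsetP : tF => /(_ i j Logic.I Logic.I ij) F0.
  have : (F i `&` F j) ((enorm x)^-1 *: x) by split.
  by rewrite F0.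
- by apply: bigcup_measurable => k _; exact: measurable_cone.
Qed.

HB.instance Definition _ := isMeasure.Build _ _ _ borel_surface
  bs0 bs_ge0 bs_sigma_additive.

Definition rvS := caratheodory_type (mu_ext borel_surface).

Definition surface : set rvS -> \bar R :=
  @completed_measure_extension _ _ _ borel_surface.

HB.instance Definition _ := Measure.on surface.

End sphere.
Arguments sphere R n : clear implicits.
Arguments rvS R n : clear implicits.
Arguments surface R n : clear implicits.

Section commutators.
Context {R : realType} {n : nat}.
Local Notation V := 'rV[R]_n.
Local Notation lambda := (lebesgue R n).
Implicit Types (x y a : V) (A D E K Q : set V) (w : V -> R) (b f g : V -> R[i]).

Definition vol A : R := fine (lambda A).

Definition cube a (l : R) : set V :=
  [set x | forall i, a ord0 i <= x ord0 i <= a ord0 i + l].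

Definition is_cube Q := exists a, exists2 l : R, 0 < l & Q = cube a l.

Definition loc_integrable w :=
  measurable_fun [set: rvL R n] w /\
  forall K, compact K -> (\int[lambda]_(x in K) `|w x|%:E < +oo)%E.

Definition cloc_integrable f :=
  loc_integrable (fun x => complex.Re (f x)) /\
  loc_integrable (fun x => complex.Im (f x)).

Definition cintegrable D f :=
  lambda.-integrable D (fun x => (complex.Re (f x))%:E) /\
  lambda.-integrable D (fun x => (complex.Im (f x))%:E).

Definition cintegral D f : R[i] :=
  ((\int[lambda]_(x in D) complex.Re (f x)) +i*
   (\int[lambda]_(x in D) complex.Im (f x)))%C.

Definition caverage f Q : R[i] := ((vol Q)^-1)%:C%C * cintegral Q f.

Definition mean_osc (alpha : R) f Q : \bar R :=
  (((vol Q `^ (1 + alpha / n%:R))^-1)%:E *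
   \int[lambda]_(x in Q) (normc (f x - caverage f Q) : R)%:E)%E.

Definition BMO (alpha : R) f :=
  cloc_integrable f /\
  (ereal_sup [set mean_osc alpha f Q | Q in is_cube] < +oo)%E.

(* The values of [x `^ r] at [x <= 0] never matter below: weights are positive
   almost everywhere. *)
Definition weight w := loc_integrable w /\ {ae lambda, forall x, 0 < w x}.

Definition eaverage w Q : \bar R :=
  (((vol Q)^-1)%:E * \int[lambda]_(x in Q) (w x)%:E)%E.

Definition Apq_char (p q : R) w Q : \bar R :=
  let p' := (1 - p^-1)^-1 in
  (eaverage (fun x => (w x `^ q)%R) Q `^ q^-1 *
   eaverage (fun x => (w x `^ (- p'))%R) Q `^ p'^-1)%E.

Definition Apq (p q : R) w :=
  weight w /\ (ereal_sup [set Apq_char p q w Q | Q in is_cube] < +oo)%E.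

Definition wpow_measure (p : R) w E : \bar R :=
  (\int[lambda]_(x in E) (w x `^ p)%:E)%E.

Definition wLnorm (q : R) w g : \bar R :=
  ((\int[lambda]_x (normc (g x) `^ q * w x `^ q)%:E) `^ q^-1)%E.

Definition hom0 (Omega : V -> R) x : R := Omega ((enorm x)^-1 *: x).

Definition rough_kernel (Omega : V -> R) (beta : R) x : R :=
  hom0 Omega x / enorm x `^ (n%:R - beta).

(* [T_b^1 f = b (T f) - T (b f)] and [T_b^m = [b, T_b^(m-1)]] amount to inserting
   [(b x - b y) ^+ m] in the integral defining [T]. *)
Definition iter_comm_integrand (Omega : V -> R) (beta : R) b (m : nat) f x y : R[i] :=
  (b x - b y) ^+ m * (rough_kernel Omega beta (x - y))%:C%C * f y.

Definition iter_comm_truncated (Omega : V -> R) (beta : R) b (m : nat) f x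
    (e : R) : R[i] :=
  cintegral [set y | e < enorm (x - y)] (iter_comm_integrand Omega beta b m f x).

(* The integral defining the commutator at [x] makes sense: as a principal
   value if [beta = 0], as a Lebesgue integral otherwise. *)
Definition iter_comm_defined (Omega : V -> R) (beta : R) b (m : nat) f x : Prop :=
  if beta == 0 then
    [/\ forall e, 0 < e -> cintegrable [set y | e < enorm (x - y)]
          (iter_comm_integrand Omega beta b m f x),
        cvg (complex.Re (iter_comm_truncated Omega beta b m f x e) @[e --> 0^'+]) &
        cvg (complex.Im (iter_comm_truncated Omega beta b m f x e) @[e --> 0^'+])]
  else cintegrable [set: V] (iter_comm_integrand Omega beta b m f x).

Definition iter_comm (Omega : V -> R) (beta : R) b (m : nat) f x : R[i] :=
  if beta == 0 then
    ((lim (complex.Re (iter_comm_truncated Omega beta b m f x e) @[e --> 0^'+])) +i*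
     (lim (complex.Im (iter_comm_truncated Omega beta b m f x e) @[e --> 0^'+])))%C
  else cintegral [set: V] (iter_comm_integrand Omega beta b m f x).

Definition cindic E y : R[i] := (\1_E y : R)%:C%C.

End commutators.

(* Main.v *)
Require Import Defs.
From mathcomp Require Import all_boot all_order all_algebra.
From mathcomp Require Import complex.
From mathcomp Require Import all_classical all_reals all_analysis.
From mathcomp Require Import measurable_realfun ring lra.

(* The kernel is positive (up to a global sign) on a cone over an open part of the
   sphere, and Lebesgue's density theorem gives a cube [Z] in that cone with
   [Omega > eps] on most of [Z]. Given a cube [Q] of side [l], some cube [P] of
   side [l] at distance comparable to [l] satisfies [Q - P `<=` lam Z], with [lam]
   comparable to [l]: for every [x] in [Q] the kernel [y |-> K (x - y)] is
   nonnegative almost everywhere on [P], and bounded below by a multiple of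
   [l^(beta - n)] outside a quarter of [P].
   Let [c] be a median on [P] of the real (or imaginary) part [u] of [b],
   [E] the part of [Q] where [u <= c] and [F] the part of [P] where [u >= c]. Then
   [u x - u y] has constant sign on [E] times [F], there is no cancellation, and
   [|T_b^m 1_F (x)| >= kappa l^beta |u x - c|^m] on [E]. Hoelder's inequality and the
   [A_{p,q}] condition on a cube containing [P] and [Q] turn the assumed bound into
   [\int_E |u - c|^m <= C |Q|^(1 + m alpha / n)]; the other half of [Q] is
   symmetric, and [t <= s + t^m / s^(m-1)] with [s = l^alpha] gives the result. *)

Set Implicit Arguments.
Unset Strict Implicit.

Import Order.TTheory GRing.Theory Num.Theory.
Import numFieldNormedType.Exports.

Local Open Scope classical_set_scope.
Local Open Scope ring_scope.

(** * Lebesgue measure under affine maps *)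

(** Its size does not change: [F] fills at least half of [P], the bad part at most a quarter, so for
    every [x] the good points of [F] still fill a quarter of [P]. On the bad part the sign of the
    kernel is all that is known, and all that is required, since nothing there can cancel the
    contribution of the good part.

    The density theorem is reduced to approximating Borel sets in measure by unions of dyadic cubes
    of one level, followed by a pigeonhole over the cubes; no covering lemma or maximal function
    enters.

    The measures of the statement live on completed sigma-algebras, while scaling and cones are
    computed on Borel sets. Null sets and pieces of the sphere are therefore first replaced by Borel
    ones, through hulls for the outer measure. The commutator itself comes with no measurability, so
    it is only compared through integrals of nonnegative functions that are monotone without it. *)

Lemma mu_ext_hull d (T : measurableType d) (R : realType)
    (mu : {measure set T -> \bar R}) (A : set T) : ((mu^*)%mu A < +oo)%E ->
  exists W, [/\ measurable W, A `<=` W & mu W = (mu^*)%mu A].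
Proof.
move=> Aoo.
have fA : (mu^*)%mu A \is a fin_num by rewrite ge0_fin_numE// mu_ext_ge0.
have cov (k : nat) : exists W, [/\ measurable W, A `<=` W &
    (mu W <= (mu^*)%mu A + (k.+1%:R^-1)%:E)%E].
  have k0 : 0 < k.+1%:R^-1 :> R by rewrite invr_gt0.
  have [_ [F [mF AF] <-] ltF] := lb_ereal_inf_adherent k0 fA.
  exists (\bigcup_i F i); split => //; first exact: bigcupT_measurable.
  apply: (le_trans _ (ltW ltF)).
  by apply: measure_sigma_subadditive => //; exact: bigcupT_measurable.
have [F HF] := choice cov.
exists (\bigcap_k F k); split.
- by apply: bigcapT_measurable => k; have [] := HF k.
- by apply: sub_bigcap => k _; have [] := HF k.
apply/eqP; rewrite eq_le; apply/andP; split.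
  apply/lee_addgt0Pr => e e0.
  have [k ke] : exists k : nat, k.+1%:R^-1 < e.
    have [k _ hk] := near_infty_natSinv_lt (PosNum e0).
    by exists k; apply: hk => /=.
  have [mF _ leF] := HF k.
  apply: (@le_trans _ _ (mu (F k))).
    apply: le_measure; rewrite ?inE//; last exact: bigcap_inf.
    by apply: bigcapT_measurable => j; have [] := HF j.
  by apply: (le_trans leF); rewrite leeD2l// lee_fin ltW.
rewrite -[leRHS]measurable_mu_extE; last first.
  by apply: bigcapT_measurable => k; have [] := HF k.
by apply: le_mu_ext; apply: sub_bigcap => k _; have [] := HF k.
Qed.

Lemma caratheodory_inner d (T : measurableType d) (R : realType)
    (mu : {measure set T -> \bar R}) (A : set T) :
  (mu setT < +oo)%E -> (mu^*)%mu.-cara.-measurable A ->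
  exists B, [/\ measurable B, B `<=` A & mu B = (mu^*)%mu A].
Proof.
move=> muT mA.
have extT : (mu^*)%mu setT = mu setT by rewrite measurable_mu_extE.
have foo X : ((mu^*)%mu X < +oo)%E.
  by apply: le_lt_trans muT; rewrite -extT; exact: le_mu_ext.
have [W [mW AW muW]] := @mu_ext_hull _ _ _ mu (~` A) (foo _).
exists (~` W); split; first exact: measurableC.
  by move=> x Ox; apply: contrapT => /AW.
have finX X : (mu^*)%mu X \is a fin_num by rewrite ge0_fin_numE// mu_ext_ge0.
have h1 : mu setT = ((mu^*)%mu A + (mu^*)%mu (~` A))%E.
  by rewrite -extT (mA setT) !setTI.

have h2 : mu setT = (mu W + mu (~` W))%E.
  rewrite -measureU ?setUCr//; first exact: measurableC.
  exact: setICr.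
move: h1; rewrite h2 muW addeC => /esym h1.
have f1 : mu (~` W) \is a fin_num.
  rewrite ge0_fin_numE//; apply: le_lt_trans muT.
  by apply: le_measure; rewrite ?inE//; exact: measurableC.
move: h1; rewrite -(fineK f1) -(fineK (finX A)) -(fineK (finX (~` A))).
by rewrite -!EFinD => -[h1]; congr EFin; lra.
Qed.

Lemma mule_cancel3 (R : realDomainType) (a b c : R) (x y : \bar R) :
  a * (b * c) = 1 -> (a%:E * (b%:E * x * (c%:E * y)) = x * y)%E.
Proof. by move=> abc; rewrite muleACA -EFinM muleA -EFinM abc mul1e. Qed.

Section lebesgue_affine.
Context (R : realType).

Let affine1 (v c : R) (x : measurableTypeR R) : measurableTypeR R := v + c * x.

Let measurable_affine1 v c : measurable_fun setT (affine1 v c).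
Proof. by apply: measurable_funD => //; apply: measurable_funM. Qed.

(** The image of Lebesgue measure, multiplied by [|c|], gives half-open intervals their length, and
    this determines Lebesgue measure. *)
Lemma lebesgue_measure_affine (v c : R) (A : set (measurableTypeR R)) :
  c != 0 -> measurable A ->
  lebesgue_measure ((fun x => v + c * x) @^-1` A) =
  ((`|c|^-1)%:E * lebesgue_measure A :> \bar R)%E.
Proof.
move=> c0 mA.
have nc : 0 < `|c| by rewrite normr_gt0.
pose cc : {nonneg R} := NngNum (normr_ge0 c).
have -> := @lebesgue_measure_unique R
    (mscale cc (pushforward lebesgue_measure (affine1 v c))) _ A mA.
  by rewrite /mscale /= muleA -EFinM mulVf ?gt_eqF// mul1e.
move=> _ [[a b]] _ <- /=; rewrite /mscale/= /pushforward /=.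
have [c_gt0|c_lt0] : 0 < c \/ c < 0 by apply/orP; rewrite orbC -neq_lt.
- rewrite (_ : affine1 v c @^-1` _ = `](a - v) / c, (b - v) / c]%classic).
    rewrite !lebesgue_measure_itv/= !lte_fin ltr_pM2r ?invr_gt0// ltrD2r.
    case: ifPn => _; last by rewrite mule0.
    by rewrite -!EFinB -EFinM gtr0_norm//; congr EFin; field; rewrite gt_eqF.
  apply/seteqP; split => x /=; rewrite !in_itv/= /affine1.
    by rewrite ltr_pdivrMr// ler_pdivlMr// => /andP[? ?]; apply/andP; split; lra.
  by rewrite ltr_pdivrMr// ler_pdivlMr// => /andP[? ?]; apply/andP; split; lra.
(* A negative slope exchanges the ends, so the closed end changes side; the length is the same. *)
- rewrite (_ : affine1 v c @^-1` _ = `[(b - v) / c, (a - v) / c[%classic).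
    rewrite !lebesgue_measure_itv/= !lte_fin ltr_nM2r ?invr_lt0// ltrD2r.
    case: ifPn => _; last by rewrite mule0.
    by rewrite -!EFinB -EFinM ltr0_norm//; congr EFin; field; rewrite lt_eqF.
  apply/seteqP; split => x /=; rewrite !in_itv/= /affine1.
    by rewrite ltr_ndivlMr// ler_ndivrMr// => /andP[? ?]; apply/andP; split; lra.
  by rewrite ltr_ndivlMr// ler_ndivrMr// => /andP[? ?]; apply/andP; split; lra.
Qed.

Lemma measurable_rv_affine n (v : 'rV[R]_n) (c : R) :
  measurable_fun setT (fun x : 'rV[R]_n => v + c *: x).
Proof.
apply: measurable_fun_rvP => i; under eq_fun do rewrite mxE mxE.
apply: measurable_funD => //; apply: measurable_funM => //.
exact: measurable_rv_coord.
Qed.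

Lemma measurable_rv_affine_preimage n (v : 'rV[R]_n) (c : R) A : measurable A ->
  measurable ((fun x : 'rV[R]_n => v + c *: x) @^-1` A).
Proof.
by move=> mA; rewrite -[X in measurable X]setTI; exact: measurable_rv_affine.
Qed.

Lemma rv_cons_lshift n (t : measurableTypeR R * 'rV[R]_n) (j : 'I_1) :
  rv_cons t ord0 (lshift n j) = t.1.
Proof. by rewrite row_mxEl (ord1 j) mxE eqxx mulr1n. Qed.

Lemma rv_cons_rshift n (t : measurableTypeR R * 'rV[R]_n) (j : 'I_n) :
  rv_cons t ord0 (rshift 1 j) = t.2 ord0 j.
Proof. by rewrite row_mxEr. Qed.

(** Induction on the dimension: the map acts separately on the first coordinate and on the others,
    so the scaled image measure agrees with the product measure on rectangles. *)
Lemma borel_lebesgue_affine n (v : 'rV[R]_n) (c : R) (A : set 'rV[R]_n) :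
  c != 0 -> measurable A ->
  borel_lebesgue R n ((fun x => v + c *: x) @^-1` A) =
  (((`|c| ^+ n)^-1)%:E * borel_lebesgue R n A)%E.
Proof.
move=> c0; have nc : 0 < `|c| by rewrite normr_gt0.
elim: n v A => [|n IH] v A mA.
  rewrite expr0 invr1 mul1e /= !diracE.
  rewrite (_ : _ @^-1` A = A)//; apply/seteqP.
  by split => x /=; rewrite (_ : v + c *: x = x)//; apply/rowP => -[].
pose cc : {nonneg R} := NngNum (exprn_ge0 n.+1 (normr_ge0 c)).
pose v' : 'rV[R]_(1 + n) := v.
pose aff (x : measurableTypeR R * 'rV[R]_n) : measurableTypeR R * 'rV[R]_n :=
  (affine1 (v' ord0 (lshift n ord0)) c x.1, rsubmx v' + c *: x.2).
have maff : measurable_fun setT aff.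
  apply: measurable_fun_pair => /=.
    by apply: (measurableT_comp (measurable_affine1 _ _)).
  apply: measurable_fun_rvP => i; under eq_fun do rewrite !mxE.
  apply: measurable_funD => //; apply: measurable_funM => //.
  by apply: (measurableT_comp (measurable_rv_coord i)).
have mpre : measurable (@rv_cons R n @^-1` A).
  by rewrite -[X in measurable X]setTI; exact: measurable_rv_cons.
have affE : (fun x : 'rV[R]_n.+1 => v + c *: x) \o @rv_cons R n = @rv_cons R n \o aff.
  apply/funext => -[t x]; apply/rowP => i0 /=.
  have E (i : 'I_(1 + n)) : (v' + c *: rv_cons (t, x)) ord0 i = rv_cons (aff (t, x)) ord0 i.
    rewrite mxE [X in _ + X]mxE; case: (split_ordP i) => j ->.
      by rewrite !rv_cons_lshift (ord1 j).
    by rewrite !rv_cons_rshift !mxE.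
  exact: E.
have preE : @rv_cons R n @^-1` ((fun x : 'rV[R]_n.+1 => v + c *: x) @^-1` A) =
    aff @^-1` (@rv_cons R n @^-1` A).
  exact: (congr1 (fun f => f @^-1` A) affE).
have -> : borel_lebesgue R n.+1 ((fun x : 'rV[R]_n.+1 => v + c *: x) @^-1` A) =
   (lebesgue_measure \x borel_lebesgue R n)%E
     (@rv_cons R n @^-1` ((fun x : 'rV[R]_n.+1 => v + c *: x) @^-1` A)) by [].
have -> : borel_lebesgue R n.+1 A =
   (lebesgue_measure \x borel_lebesgue R n)%E (@rv_cons R n @^-1` A) by [].
have -> := @product_measure_unique _ _ _ _ _ lebesgue_measure (borel_lebesgue R n)
  (mscale cc (pushforward (lebesgue_measure \x borel_lebesgue R n)%E aff)) _ _ mpre.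
  rewrite /mscale /= muleA -EFinM mulVf ?mul1e//; last by rewrite expf_neq0// gt_eqF.
  exact: (congr1 (lebesgue_measure \x borel_lebesgue R n)%E preE).
move=> A1 B1 mA1 mB1.
transitivity ((`|c| ^+ n.+1)%:E * (lebesgue_measure \x borel_lebesgue R n)%E
   ((affine1 (v' ord0 (lshift n ord0)) c @^-1` A1) `*`
  ((fun x => rsubmx v' + c *: x)%R @^-1` B1)))%E; first by [].
rewrite product_measure1E//; last 2 first.
- by rewrite -[X in measurable X]setTI; exact: measurable_affine1.
- exact: measurable_rv_affine_preimage.
have E1 : lebesgue_measure (affine1 (v' ord0 (lshift n ord0)) c @^-1` A1) = _ :=
  lebesgue_measure_affine _ c0 mA1.
have E2 := IH (rsubmx v') B1 mB1.
transitivity ((`|c| ^+ n.+1)%:E * ((`|c|^-1)%:E * lebesgue_measure A1 *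
    ((`|c| ^+ n)^-1%:E * borel_lebesgue R n B1)))%E.
  by congr (_ * (_ * _))%E; [exact: E1|exact: E2].
apply: mule_cancel3; rewrite exprS; field.
by rewrite expf_neq0 gt_eqF.
Qed.

End lebesgue_affine.

(** * Density of dyadic cubes *)

(** The integer [Num.floor y] separates [x] from [y], and its product with [c] separates [c * x]
    from [c * y]. This makes the dyadic grids nested. *)
Lemma floor_lt_scaled (R : realType) (c : nat) (x y : R) : (0 < c)%N ->
  (Num.floor x < Num.floor y)%R ->
  (Num.floor (c%:R * x) < Num.floor (c%:R * y))%R.
Proof.
move=> c0 xy; have c0' : 0 < c%:R :> R by rewrite ltr0n.
have xN : x < (Num.floor y)%:~R.
  by apply: (lt_le_trans (floorD1_gt x)); rewrite ler_int lezD1.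
have Ny : (Num.floor y)%:~R <= y := floor_le y.
have E : (c%:R * (Num.floor y)%:~R : R) = ((c%:Z * Num.floor y)%:~R).
  by rewrite intrM.
apply: (@lt_le_trans _ _ (c%:Z * Num.floor y)).
  by rewrite floor_lt_int -E ltr_pM2l.
by rewrite floor_ge_int -E ler_pM2l.
Qed.

Lemma measurable_box (R : realType) n (I : 'I_n -> interval R) :
  measurable [set x : 'rV[R]_n | forall i, x ord0 i \in I i].
Proof.
have -> : [set x : 'rV[R]_n | forall i, x ord0 i \in I i] =
    \bigcap_(i in [set: 'I_n]) (@rv_coord R n i @^-1` [set` I i]).
  by apply/seteqP; split => [x h i _|x h i]; [exact: h|exact: (h i Logic.I)].
apply: fin_bigcap_measurable => // i _; rewrite -[X in measurable X]setTI.
exact: measurable_rv_coord.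
Qed.

Lemma measurable_cube (R : realType) n (a : 'rV[R]_n) l : measurable (cube a l).
Proof.
have := measurable_box (fun i => `[a ord0 i, a ord0 i + l]).
by congr measurable; apply/seteqP; split => x h i; have := h i; rewrite in_itv.
Qed.

Section dyadic.
Context (R : realType) (n : nat).
Implicit Types (x y z : 'rV[R]_n) (A D V W Z : set 'rV[R]_n).
Local Notation mu := (borel_lebesgue R n).

(** The index of the dyadic cube of side [2^-k] containing [x]. Finite functions into [int] form a
    countable type, so the cubes can be enumerated with [pickle]. *)
Definition dyad (k : nat) x : {ffun 'I_n -> int} :=
  [ffun i => Num.floor ((2 ^ k)%N%:R * x ord0 i)].

Definition dcell k s : set 'rV[R]_n := [set x | dyad k x = s].

Lemma dyad_le k l x y : (k <= l)%N -> dyad l x = dyad l y -> dyad k x = dyad k y.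
Proof.
move=> kl /ffunP xy; apply/ffunP => i; rewrite !ffunE.
have {xy} := xy i; rewrite !ffunE.
have E (t : R) : (2 ^ l)%N%:R * t = (2 ^ (l - k))%N%:R * ((2 ^ k)%N%:R * t).
  by rewrite mulrA -natrM -expnD subnK.
rewrite 2!E => xy; apply/eqP; rewrite eq_le !leNgt.
have c0 : (0 < 2 ^ (l - k))%N by rewrite expn_gt0.
by apply/andP; split; apply/negP => /(floor_lt_scaled c0); rewrite xy ltxx.
Qed.

Lemma dcellE k s : dcell k s = [set x | forall i,
  (s i)%:~R / (2 ^ k)%N%:R <= x ord0 i < (s i)%:~R / (2 ^ k)%N%:R + (2 ^ k)%N%:R^-1].
Proof.
have k0 : 0 < (2 ^ k)%N%:R :> R by rewrite ltr0n expn_gt0.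
have E (a t : R) : (a / (2 ^ k)%N%:R <= t < a / (2 ^ k)%N%:R + (2 ^ k)%N%:R^-1) =
    (a <= (2 ^ k)%N%:R * t < a + 1).
  rewrite -{3}[_^-1]mul1r -mulrDl ler_pdivrMr// ltr_pdivlMr//.
  by rewrite [t * _]mulrC.
apply/seteqP; split => x /=.
  by move=> <- i; rewrite E ffunE floor_le /= -[1]/(1%:~R) -intrD floorD1_gt.
move=> xs; apply/ffunP => i; rewrite ffunE; apply: floor_def.
by rewrite intrD -E.
Qed.

Lemma measurable_dcell k s : measurable (dcell k s).
Proof.
rewrite dcellE; have := measurable_box (fun i => `[(s i)%:~R / (2 ^ k)%N%:R : R,
  (s i)%:~R / (2 ^ k)%N%:R + (2 ^ k)%N%:R^-1[).
by congr measurable; apply/seteqP; split => x h i; have := h i; rewrite in_itv.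
Qed.

Lemma dcell_le k s : (mu (dcell k s) <= (((2 ^ k)%N%:R^-1) ^+ n)%:E)%E.
Proof.
have k0 : 0 <= (2 ^ k)%N%:R^-1 :> R by rewrite invr_ge0 ler0n.
rewrite -(borel_lebesgue_cube (\row_i ((s i)%:~R / (2 ^ k)%N%:R)) k0).
apply: le_measure; rewrite ?inE; first exact: measurable_dcell.
  exact: measurable_cube.
by rewrite dcellE => x h i; rewrite mxE; have /andP[-> /ltW ->] := h i.
Qed.

(** In other words, [D] is a union of dyadic cubes of level [k]. *)
Definition dsaturated k D := forall x y, dyad k x = dyad k y -> D x -> D y.

Lemma dsaturated_le k l D : (k <= l)%N -> dsaturated k D -> dsaturated l D.
Proof. by move=> kl sD x y xy; apply: sD; exact: dyad_le xy. Qed.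

(** Approximation in measure inside a window [Z] by unions of dyadic cubes of a single level. The
    sets with this property form a sigma-algebra when [Z] has finite measure. *)
Definition approximable Z A := measurable A /\ forall e : R, 0 < e ->
  exists k D, [/\ dsaturated k D, measurable D &
    (mu (Z `&` (A `\` D `|` D `\` A)) <= e%:E)%E].

Variable Z : set 'rV[R]_n.
Hypotheses (mZ : measurable Z) (Zoo : (mu Z < +oo)%E).

Lemma dsaturated_approximable k D : dsaturated k D -> measurable D ->
  approximable Z D.
Proof.
move=> sD mD; split=> // e e0; exists k, D; split => //.
by rewrite setDv setU0 setI0 measure0 lee_fin ltW.
Qed.

Lemma approximableC A : approximable Z A -> approximable Z (~` A).
Proof.
move=> [mA aA]; split; first exact: measurableC.
move=> e /aA[k [D [sD mD De]]]; exists k, (~` D); split.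
- by move=> x y xy nDx Dy; apply: nDx; apply: sD Dy.
- exact: measurableC.
- rewrite [X in Z `&` X](_ : _ = A `\` D `|` D `\` A)//.
  by rewrite !setDE !setCK setUC; congr (_ `|` _); exact: setIC.
Qed.

Lemma approximableU A B : approximable Z A -> approximable Z B ->
  approximable Z (A `|` B).
Proof.
move=> [mA aA] [mB aB]; split; first exact: measurableU.
move=> e e0; have e2 : 0 < e / 2 by rewrite divr_gt0.
have [k [D [sD mD De]]] := aA _ e2; have [l [F [sF mF Fe]]] := aB _ e2.
exists (maxn k l), (D `|` F); split.
- have sD' := dsaturated_le (leq_maxl k l) sD.
  have sF' := dsaturated_le (leq_maxr k l) sF.
  by move=> x y xy [Dx|Fx]; [left; exact: sD' Dx|right; exact: sF' Fx].
- exact: measurableU.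
have md X Y : measurable X -> measurable Y ->
    measurable (Z `&` (X `\` Y `|` Y `\` X)).
  by move=> mX mY; apply: measurableI => //; apply: measurableU; exact: measurableD.
apply: (@le_trans _ _ (mu (Z `&` (A `\` D `|` D `\` A)) +
    mu (Z `&` (B `\` F `|` F `\` B)))%E).
  apply: (le_trans _ (measureU2 _ _ _)); try exact: md.
  apply: le_measure; rewrite ?inE; first by apply: md; exact: measurableU.
    by apply: measurableU; exact: md.
  move=> x [Zx [[[Ax|Bx] /not_orP[nD nF]]|[[Dx|Fx] /not_orP[nA nB]]]].
  - by left; split => //; left.
  - by right; split => //; left.
  - by left; split => //; right.
  - by right; split => //; right.
by rewrite [e]splitr EFinD; apply: leeD.
Qed.

(** Since [Z] has finite measure, the part of [Z] that the first [N] sets miss has measure tending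
    to 0; half of [e] pays for it and half for approximating the finite union. *)
Lemma approximable_bigcup (F : (set 'rV[R]_n)^nat) :
  (forall i, approximable Z (F i)) -> approximable Z (\bigcup_i F i).
Proof.
move=> aF; have mF i : measurable (F i) by have [] := aF i.
have mUF : measurable (\bigcup_i F i) by exact: bigcupT_measurable.
split => // e e0; have e2 : 0 < e / 2 by rewrite divr_gt0.
have aU k : approximable Z (\big[setU/set0]_(i < k) F i).
  elim: k => [|k IH]; last by rewrite big_ord_recr; exact: approximableU.
  rewrite big_ord0; apply: (@dsaturated_approximable 0) => //.
pose G k := Z `&` (\bigcup_i F i `\` \big[setU/set0]_(i < k) F i).
have mG k : measurable (G k).
  apply: measurableI => //; apply: measurableD => //.
  by have [] := aU k.
have G0 : \bigcap_k G k = set0.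
  rewrite -subset0 => x Gx; have [_ [[i _ Fix] _]] := Gx 0%N Logic.I.
  have [_ [_]] := Gx i.+1 Logic.I; apply.
  by rewrite big_ord_recr; right.
have cG : mu (G k) @[k --> \oo] --> 0%E.
  rewrite -(measure0 mu) -G0; apply: nonincreasing_cvg_mu => //.
  - apply: le_lt_trans Zoo; apply: le_measure; rewrite ?inE//.
    by move=> x [].
  - by rewrite G0.
  - move=> a c ac; apply/subsetPset => x [Zx [Ux nx]]; split => //; split => // h.
    apply: nx; move: h; rewrite -!bigcup_mkord => -[i ia Fx]; exists i => //=.
    exact: leq_trans ia ac.
have [N _ /(_ N (leqnn _)) /= GN] : \forall k \near \oo, (mu (G k) < (e / 2)%:E)%E.
  apply: (cG [set y | (y < (e / 2)%:E)%E]); rewrite /nbhs /=.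
  by apply: filterS (lt_nbhsl e2) => x; rewrite /= lte_fin.
have [k [D [sD mD De]]] := (aU N).2 _ e2.
exists k, D; split => //.
have mUN : measurable (\big[setU/set0]_(i < N) F i) by have [] := aU N.
have mdif X : measurable X -> measurable (Z `&` (X `\` D `|` D `\` X)).
  by move=> mX; apply: measurableI => //; apply: measurableU; exact: measurableD.
rewrite [e]splitr EFinD.
apply: le_trans (leeD (ltW GN) De).
apply: (le_trans _ (measureU2 _ _ _)) => //; last exact: mdif.
apply: le_measure; rewrite ?inE; first exact: mdif.
  by apply: measurableU => //; exact: mdif.
move=> x [Zx [[Ux nDx]|[Dx nUx]]].
  have [UNx|nUNx] := pselect ((\big[setU/set0]_(i < N) F i) x).
    by right; split => //; left.
  by left.
right; split => //; right; split => // h; apply: nUx.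
by move: h; rewrite -bigcup_mkord => -[i _ Fx]; exists i.
Qed.

Lemma measurable_approximable A : measurable A -> approximable Z A.
Proof.
have aT : approximable Z set0 by apply: (@dsaturated_approximable 0).
apply: smallest_sub.
  split => //= [B aB|F aF]; last exact: approximable_bigcup.
  by rewrite setTD; exact: approximableC.
rewrite -bigcup_seq; apply: bigcup_sub => i _ _ [Y mY <-].
rewrite setTI.
have {mY} : (@ocitv R).-sigma.-measurable Y by exact: mY.
rewrite RGenOInfty.measurableE; move: Y.
apply: (@smallest_sub _ (sigma_algebra setT) _
  [set Y | approximable Z (rv_coord i @^-1` Y)]).
  split => [|B aB|F aF] /=.
  - by rewrite preimage_set0.
  - by rewrite setTD preimage_setC; exact: approximableC.
  - by rewrite preimage_bigcup; exact: approximable_bigcup.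
move=> _ [a ->] /=.
(* The half line []a, +oo[] rounded to level [k]: points whose dyadic interval starts after [a]. It
   is saturated, and these sets exhaust the half line. *)
pose P k := [set t : R | a < (Num.floor ((2 ^ k)%N%:R * t))%:~R / (2 ^ k)%N%:R].
have P0 k : 0 < (2 ^ k)%N%:R :> R by rewrite ltr0n expn_gt0.
rewrite (_ : rv_coord i @^-1` _ = \bigcup_k (rv_coord i @^-1` (P k))).
  apply: approximable_bigcup => k.
  apply: (@dsaturated_approximable k).
    by move=> x y /ffunP/(_ i); rewrite !ffunE /P /rv_coord /= => ->.
  rewrite -[X in measurable X]setTI; apply: measurable_rv_coord => //.
  rewrite (_ : P k = `[((Num.floor (a * (2 ^ k)%N%:R) + 1)%:~R / (2 ^ k)%N%:R), +oo[%classic)//.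
  apply/seteqP; split => t; rewrite /P /= in_itv/= andbT ltr_pdivlMr//.
    by rewrite -floor_lt_int -lezD1 floor_ge_int ler_pdivrMr// [t * _]mulrC.
  by rewrite -floor_lt_int -lezD1 floor_ge_int ler_pdivrMr// [t * _]mulrC.
rewrite -preimage_bigcup; congr (_ @^-1` _).
apply/seteqP; split => t /=; rewrite in_itv/= andbT; last first.
  by move=> [k _]; rewrite /P /= => /lt_le_trans; apply; rewrite ler_pdivrMr// mulrC floor_le.
(* Any level finer than [t - a] works, because the dyadic interval of [t] starts after
   [t - 2^-k]. *)
move=> at_; have ta : 0 < t - a by rewrite subr_gt0.
pose k := Num.truncn ((t - a)^-1).
have kP : (t - a)^-1 < k.+1%:R by rewrite truncnS_gt.
have k2 : (t - a)^-1 < (2 ^ k.+1)%N%:R.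
  by apply: (lt_le_trans kP); rewrite ler_nat ltnW// ltn_expl.
exists k.+1 => //; rewrite /P /= ltr_pdivlMr//.
have := floorD1_gt ((2 ^ k.+1)%N%:R * t); rewrite intrD /=.
have : 1 < (2 ^ k.+1)%N%:R * (t - a).
  by move: k2; rewrite -[X in X < _ -> _]mul1r ltr_pdivrMr.
rewrite mulrBr [a * _]mulrC.
set u := (2 ^ k.+1)%N%:R * t; set v := (2 ^ k.+1)%N%:R * a.
set w := (Num.floor _)%:~R => h1 h2; lra.
Qed.

End dyadic.

Section dyadic_density.
Context (R : realType) (n : nat).
Implicit Types (x y z : 'rV[R]_n) (A D V W Z : set 'rV[R]_n).
Local Notation mu := (borel_lebesgue R n).

(** Numbering the cells by naturals makes countable additivity applicable; a number that codes no
    index gives the empty set. *)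
Definition dcell_at (D : set 'rV[R]_n) k (j : nat) : set 'rV[R]_n :=
  if pickle_inv j is Some s then dcell k s `&` D else set0.

Lemma bigcup_dcell_at D k : \bigcup_j dcell_at D k j = D.
Proof.
apply/seteqP; split => [x [j _]|x Dx].
  by rewrite /dcell_at; case: pickle_inv => // s [].
by exists (pickle (dyad k x)) => //; rewrite /dcell_at pickleK_inv.
Qed.

Lemma trivIset_dcell_at D k : trivIset setT (dcell_at D k).
Proof.
move=> i j _ _ [x []]; rewrite /dcell_at.
case Ei : (pickle_inv i) => [s|]//; case Ej : (pickle_inv j) => [t|]//.
move=> [xs _] [xt _]; have st : s = t by rewrite -xs -xt.
have := @pickle_invK {ffun 'I_n -> int} i; have := @pickle_invK {ffun 'I_n -> int} j.
by rewrite Ei Ej /= st => -> ->.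
Qed.

Lemma measurable_dcell_at D k j : measurable D -> measurable (dcell_at D k j).
Proof.
rewrite /dcell_at => mD; case: pickle_inv => // s; apply: measurableI => //.
exact: measurable_dcell.
Qed.

(** Sum over the cells of [D]. Used by contraposition: if the inequality fails on [D], it fails on
    some cell, which [A] then nearly fills. *)
Lemma dcell_le_saturated (A D : set 'rV[R]_n) (r : R) k : 0 <= r ->
  measurable A -> measurable D -> dsaturated k D ->
  (forall s, dcell k s `<=` D ->
     (r%:E * mu (dcell k s `&` A) <= mu (dcell k s `\` A))%E) ->
  (r%:E * mu (D `&` A) <= mu (D `\` A))%E.
Proof.
move=> r0 mA mD sD H.
have sub j (B : set 'rV[R]_n) : dcell_at D k j `&` B `<=` dcell_at D k j.
  exact: subIsetl.
have tr (B : set 'rV[R]_n) : trivIset setT (fun j => dcell_at D k j `&` B).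
  move=> i j _ _ [x [[xi _] [xj _]]]; apply: (@trivIset_dcell_at D k) => //.
  by exists x.
have E (B : set 'rV[R]_n) : measurable B ->
    mu (D `&` B) = (\sum_(0 <= j <oo) mu (dcell_at D k j `&` B))%E.
  move=> mB; rewrite -{1}(bigcup_dcell_at D k) setI_bigcupl measure_bigcup//.
  - by apply: eq_eseriesl => j; rewrite in_setT.
  - by move=> j _; apply: measurableI => //; exact: measurable_dcell_at.
rewrite setDE !E//; last exact: measurableC.
rewrite -nneseriesZl//; apply: lee_nneseries.
  by move=> j _ _; rewrite mule_ge0// lee_fin.
move=> j _; rewrite /dcell_at; case: pickle_inv => [s|]; last first.
  by rewrite !set0I !measure0 mule0.
have [sD'|nsD] := pselect (dcell k s `<=` D).
  by rewrite (setIidl sD') -setDE; exact: H.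
suff -> : dcell k s `&` D = set0 by rewrite !set0I !measure0 mule0.
rewrite -subset0 => x [xs Dx]; apply: nsD => y ys.
by apply: sD Dx; rewrite xs.
Qed.

Lemma open_dcell V x : open V -> V x -> exists k, dcell k (dyad k x) `<=` V.
Proof.
move=> oV Vx; have /nbhs_ballP[e /= e0 eV] : nbhs x V by exact: open_nbhs_nbhs.
pose k := Num.truncn (e^-1).
have k2 : e^-1 < (2 ^ k.+1)%N%:R :> R.
  by apply: (lt_le_trans (truncnS_gt _)); rewrite ler_nat ltnW// ltn_expl.
have p2 : 0 < (2 ^ k.+1)%N%:R :> R by rewrite ltr0n expn_gt0.
have ke : (2 ^ k.+1)%N%:R^-1 < e by rewrite invf_plt.
exists k.+1 => y xy; apply: eV; split=> // i j; rewrite (ord1 i).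
have : dcell k.+1 (dyad k.+1 x) x by [].
move: xy; rewrite dcellE /= => /(_ j)/andP[y1 y2] /(_ j)/andP[x1 x2].
apply: (lt_trans _ ke).
by rewrite ltr_norml; apply/andP; split; lra.
Qed.

Definition hocube z (l : R) : set 'rV[R]_n :=
  [set x | forall i, z ord0 i <= x ord0 i < z ord0 i + l].

Lemma measurable_hocube z l : measurable (hocube z l).
Proof.
have := measurable_box (fun i => `[z ord0 i, z ord0 i + l[).
by congr measurable; apply/seteqP; split => x h i; have := h i; rewrite in_itv.
Qed.

Lemma dcell_hocube k s : dcell k s =
  hocube (\row_i ((s i)%:~R / (2 ^ k)%N%:R)) ((2 ^ k)%N%:R^-1).
Proof.
by rewrite dcellE; apply/seteqP; split => x h i; have := h i; rewrite mxE.
Qed.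

(* A weak form of Lebesgue's density theorem. *)
Lemma dyadic_density A V (eta : R) : open V -> measurable A -> A `<=` V ->
  (0 < mu A)%E -> 0 < eta ->
  exists z l, [/\ 0 < l, hocube z l `<=` V &
    (mu (hocube z l `\` A) <= (eta * l ^+ n)%:E)%E].
Proof.
move=> oV mA AV A0 eta0.
(* Otherwise [A] would be covered by countably many null sets, one for each dyadic cube inside
   [V]. *)
have [k0 [s0 [sV sA0]]] : exists k s, dcell k s `<=` V /\ (0 < mu (dcell k s `&` A))%E.
  apply: contrapT => H.
  have : mu.-negligible A.
    pose F j : set 'rV[R]_n := if (@pickle_inv (nat * {ffun 'I_n -> int})%type j) is Some ks
      then if pselect (dcell ks.1 ks.2 `<=` V) then dcell ks.1 ks.2 `&` A else set0
      else set0.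
    apply: (@negligibleS _ _ _ mu (\bigcup_j F j)).
      move=> x Ax; have [k kV] := open_dcell oV (AV _ Ax).
      exists (pickle (k, dyad k x)) => //; rewrite /F pickleK_inv /=.
      by case: pselect.
    apply: negligible_bigcup => j; rewrite /F.
    case: pickle_inv => [[k s]|]; last exact: negligible_set0.
    case: pselect => /= [kV|_]; last exact: negligible_set0.
    apply/negligibleP; first by apply: measurableI => //; exact: measurable_dcell.
    apply/eqP; rewrite eq_le measure_ge0 andbT leNgt; apply/negP => h.
    by apply: H; exists k, s.
  by move/negligibleP => /(_ mA) A00; rewrite A00 ltxx in A0.
set Z := dcell k0 s0 in sV sA0.
have mZ : measurable Z by exact: measurable_dcell.
have Zoo : (mu Z < +oo)%E by apply: (le_lt_trans (dcell_le _ _ _)); rewrite ltry.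
have mZA : measurable (Z `&` A) by exact: measurableI.
have ZAfin : mu (Z `&` A) \is a fin_num.
  by rewrite ge0_fin_numE// (le_lt_trans _ Zoo)//; apply: le_measure; rewrite ?inE.
pose a := fine (mu (Z `&` A)).
have aE : mu (Z `&` A) = a%:E by rewrite fineK.
have a0 : 0 < a by rewrite -lte_fin -aE.
(* Chosen so that [e * (1 + eta) = eta * a / 2], whence [eta * (a - e) > e]. *)
pose e := eta * a / (2 * (1 + eta)).
have e0 : 0 < e by rewrite divr_gt0 ?mulr_gt0// addr_gt0.
have [k [D' [sD' mD' D'e]]] := (measurable_approximable mZ Zoo mA).2 _ e0.
pose l := maxn k0 k.
pose D := Z `&` D'.
have mD : measurable D by exact: measurableI.
have sD : dsaturated l D.
  move=> x y xy [Zx Dx]; split; last exact: (dsaturated_le (leq_maxr k0 k) sD' xy).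
  by rewrite /Z /dcell /= -(dyad_le (leq_maxl k0 k) xy).
have DA : (mu (D `\` A) <= e%:E)%E.
  apply: le_trans D'e; apply: le_measure; rewrite ?inE.
  - exact: measurableD.
  - by apply: measurableI => //; apply: measurableU; exact: measurableD.
  - by move=> x [[Zx Dx] nAx]; split => //; right.
have AD : (a%:E - e%:E <= mu (D `&` A))%E.
  rewrite -aE leeBlDr//.
  apply: (@le_trans _ _ (mu (D `&` A) + mu (Z `&` (A `\` D' `|` D' `\` A)))%E); last first.
    by rewrite leeD2l.
  apply: (le_trans _ (measureU2 _ _ _)).
  - apply: le_measure; rewrite ?inE//.
      apply: measurableU; first exact: measurableI.
      by apply: measurableI => //; apply: measurableU; exact: measurableD.
    move=> x [Zx Ax]; have [Dx|nDx] := pselect (D' x); first by left.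
    by right; split => //; left.
  - exact: measurableI.
  - by apply: measurableI => //; apply: measurableU; exact: measurableD.
(* If [A] missed too much of every cell of [D], summation would give [eta * (a - e) <= e], against
   the choice of [e]. *)
apply: contrapT => H.
have : (eta%:E * mu (D `&` A) <= mu (D `\` A))%E.
  apply: (@dcell_le_saturated _ _ _ l) => //; first exact: ltW.
  move=> s sDs; rewrite leNgt; apply/negP => lts.
  apply: H; exists (\row_i ((s i)%:~R / (2 ^ l)%N%:R)), ((2 ^ l)%N%:R^-1).
  rewrite -dcell_hocube; split.
  - by rewrite invr_gt0 ltr0n expn_gt0.
  - by move=> x /sDs[Zx _]; exact: sV.
  apply: (le_trans (ltW lts)); rewrite EFinM lee_pmul2l//.
  apply: le_trans (dcell_le _ _ _).
  apply: le_measure; rewrite ?inE//; try exact: measurable_dcell.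
  by apply: measurableI => //; exact: measurable_dcell.
move=> h; have : (eta%:E * (a%:E - e%:E) <= e%:E)%E.
  by apply: (le_trans _ (le_trans h DA)); rewrite lee_pmul2l.
rewrite -EFinB -EFinM lee_fin leNgt => /negP; apply.
have e1 : 1 + eta != 0 by rewrite gt_eqF// addr_gt0.
have eE : e * (1 + eta) = eta * a / 2 by rewrite /e; field.
have : 0 < eta * a by exact: mulr_gt0.
by rewrite -subr_gt0; nra.
Qed.

End dyadic_density.

(** * The cone over the sphere *)

Section sector.
Context (R : realType) (n : nat).
Implicit Types (x y z : 'rV[R]_n).
Local Notation mu := (borel_lebesgue R n).

Lemma enorm_ge0 x : 0 <= enorm x. Proof. exact: sqrtr_ge0. Qed.

Lemma enormZ (c : R) x : enorm (c *: x) = `|c| * enorm x.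
Proof.
rewrite /enorm (eq_bigr (fun i => c ^+ 2 * x ord0 i ^+ 2)); last first.
  by move=> i _; rewrite mxE exprMn.
by rewrite -mulr_sumr sqrtrM ?sqr_ge0// sqrtr_sqr.
Qed.

Lemma continuous_enorm : continuous (@enorm R n).
Proof.
have c1 : continuous (fun x : 'rV[R]_n => \sum_(i < n) x ord0 i ^+ 2).
  apply: continuous_big => [|i _ x]; first exact: add_continuous.
  apply: (@continuous_comp _ _ _ (fun x : 'rV[R]_n => x ord0 i) (fun t : R => t ^+ 2)).
    exact: coord_continuous.
  exact: exprn_continuous.
by move=> x; apply: continuous_comp; [exact: c1|exact: sqrt_continuous].
Qed.

(** Cutting the cone at radius [r] keeps the density cube away from the origin; this later separates
    [Q] from [P]. *)
Definition open_sector (U : set 'rV[R]_n) (r : R) : set 'rV[R]_n :=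
  [set z | r < enorm z < 1 /\ U ((enorm z)^-1 *: z)].

Lemma open_sector_open U r : 0 <= r -> open U -> open (open_sector U r).
Proof.
move=> r0 oU; rewrite openE => z [/andP[rz z1] Uz].
have z0 : 0 < enorm z by exact: le_lt_trans rz.
have cV := cvgV (lt0r_neq0 z0) (@continuous_enorm z).
have cn : (enorm y)^-1 *: y @[y --> z] --> (enorm z)^-1 *: z.
  apply: (@cvgZ _ _ _ _ (nbhs_filter z)); [exact: cV|exact: cvg_id].
have nU : nbhs ((enorm z)^-1 *: z) U by exact: open_nbhs_nbhs.
have h1 : \forall y \near z, r < enorm y.
  by apply: (@continuous_enorm z [set t | r < t]); exact: lt_nbhsr.
have h2 : \forall y \near z, enorm y < 1.
  by apply: (@continuous_enorm z [set t | t < 1]); exact: lt_nbhsl.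
have h3 : \forall y \near z, U ((enorm y)^-1 *: y) by exact: cn.
rewrite /interior; near=> y; split; last by near: y.
by apply/andP; split; near: y.
Unshelve. all: by end_near. Qed.

Lemma measurable_rv_dir : measurable_fun setT (fun x : 'rV[R]_n => (enorm x)^-1 *: x).
Proof.
apply: measurable_fun_rvP => i; under eq_fun do rewrite mxE.
apply: measurable_funM; last exact: measurable_rv_coord.
under eq_fun do rewrite -powR_inv1 ?sqrtr_ge0//.
exact: (measurableT_comp (measurable_powR (-1)) (@measurable_enorm R n)).
Qed.

Lemma measurable_enorm_itv (i : interval R) : measurable [set x : 'rV[R]_n | enorm x \in i].
Proof.
have := @measurable_enorm R n measurableT [set` i] (measurable_itv i).
by rewrite setTI.
Qed.

Lemma measurable_cone (A : set 'rV[R]_n) : measurable A -> measurable (cone A).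
Proof.
move=> mA; rewrite (_ : cone A = [set x | enorm x \in `]0, 1[] `&`
  ((fun x => (enorm x)^-1 *: x) @^-1` A)); last first.
  by apply/seteqP; split => x /=; rewrite in_itv/=.
apply: measurableI; first exact: measurable_enorm_itv.
by rewrite -[X in measurable X]setTI; exact: measurable_rv_dir.
Qed.

Lemma open_rv_measurable (U : set 'rV[R]_n) : open U -> measurable U.
Proof.
move=> oU; pose F j : set 'rV[R]_n :=
  if @pickle_inv (nat * {ffun 'I_n -> int})%type j is Some ks
  then if pselect (dcell ks.1 ks.2 `<=` U) then dcell ks.1 ks.2 else set0 else set0.
rewrite (_ : U = \bigcup_j F j).
  apply: bigcupT_measurable => j; rewrite /F; case: pickle_inv => // -[k s].
  by case: pselect => /= [_|_] //; exact: measurable_dcell.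
apply/seteqP; split => [x Ux|x [j _]].
  have [k kV] := open_dcell oU Ux.
  by exists (pickle (k, dyad k x)) => //; rewrite /F pickleK_inv /=; case: pselect.
by rewrite /F; case: pickle_inv => // -[k s]; case: pselect => /= [kV /kV|_ []].
Qed.

Lemma borel_surface_fin : (borel_surface (n := n) (R := R) setT < +oo)%E.
Proof.
rewrite /borel_surface.
suff h : (mu (cone setT) < +oo)%E by rewrite lte_mul_pinfty.
have l0 : 0 <= 2 :> R by [].
apply: (@le_lt_trans _ _ (mu (cube (const_mx (- 1)) 2))); last first.
  by have := borel_lebesgue_cube (const_mx (- 1 : R) : 'rV[R]_n) l0; rewrite /cube => ->; rewrite ltry.
apply: le_measure; rewrite ?inE.
- exact: measurable_cone.
- exact: measurable_cube.
move=> x [/andP[_ x1] _] i; rewrite mxE.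
have xi : `|x ord0 i| < 1.
  apply: le_lt_trans x1; rewrite -sqrtr_sqr; apply: ler_wsqrtr.
  rewrite (bigD1 i)//= lerDl; apply: sumr_ge0 => j _; exact: sqr_ge0.
by move: xi; rewrite ltr_norml => /andP[? ?]; apply/andP; split; lra.
Qed.

Lemma borel_surface_cone A : (0 < n)%N -> measurable A ->
  borel_surface A = 0 -> mu (cone A) = 0.
Proof.
move=> n0 mA /eqP; rewrite /borel_surface mule_eq0 => /orP[|/eqP//].
by rewrite eqe pnatr_eq0 gtn_eqF.
Qed.

Lemma surface_measurable (A : set 'rV[R]_n) : measurable A ->
  measurable (A : set (rvS R n)).
Proof. by move=> mA; exact: caratheodory_measurable_mu_ext. Qed.

Lemma surfaceE (A : set 'rV[R]_n) :
  surface R n A = ((borel_surface (n := n) (R := R))^*)%mu A.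
Proof. by []. Qed.

Lemma surface_negligible_hull (A : set 'rV[R]_n) :
  (surface R n).-negligible (A : set (rvS R n)) ->
  exists W, [/\ measurable W, A `<=` W & borel_surface W = 0].
Proof.
move=> [B [mB B0 AB]]; rewrite surfaceE in B0.
have Boo : ((borel_surface (n := n) (R := R))^*%mu B < +oo)%E by rewrite B0 ltry.
have [W [mW BW WE]] := mu_ext_hull Boo.
by exists W; split => //; [exact: subset_trans BW|rewrite WE].
Qed.

Lemma enorm_dir x : 0 < enorm x -> enorm ((enorm x)^-1 *: x) = 1.
Proof.
by move=> x0; rewrite enormZ ger0_norm ?invr_ge0 ?enorm_ge0// mulVf// gt_eqF.
Qed.

(** Surface measure is defined through the volume of cones, so a piece of the sphere of positive
    measure where [Omega] is bounded below gives a solid set of positive volume, to which the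
    density theorem applies. [N] is the cone over the directions of the wrong sign. *)
Lemma sector_density (Omega : 'rV[R]_n -> R) (U : set 'rV[R]_n) (eta : R) :
  (0 < n)%N -> 0 < eta ->
  measurable_fun (sphere R n : set (rvS R n)) Omega -> open U ->
  {ae surface R n, forall t, (sphere R n `&` U) t -> 0 <= Omega t} ->
  ~ {ae surface R n, forall t, (sphere R n `&` U) t -> Omega t = 0} ->
  exists (z : 'rV[R]_n) (l eps : R) (A N : set 'rV[R]_n),
  [/\ 0 < l, 0 < eps, measurable A /\ (measurable N /\ mu N = 0),
   (mu (hocube z l `\` A) <= (eta * l ^+ n)%:E)%E &
   [/\ forall x, hocube z l x -> eps < enorm x < 1,
       forall x, A x -> eps < hom0 Omega x &
       forall x, hocube z l x -> ~ N x -> 0 <= hom0 Omega x]].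
Proof.
move=> n0 eta0 mO oU O0 On0.
have [W [mW NW W0]] := surface_negligible_hull O0.
pose S k : set (rvS R n) := (sphere R n `&` Omega @^-1` `]k.+1%:R^-1, +oo[) `&` U.
have mS k : measurable (S k).
  apply: measurableI; last by apply: surface_measurable; exact: open_rv_measurable.
  apply: mO; last exact: measurable_itv.
  apply: surface_measurable.
  have := measurable_enorm_itv `[1, 1]; congr measurable.
  by apply/seteqP; split => x /=; rewrite in_itv/= -eq_le; [move/eqP|move->].
(* The sets [S k] exhaust the part of [U] on the sphere where [Omega > 0]; were they all null,
   [Omega] would vanish almost everywhere there. *)
have [k Sk] : exists k, (0 < surface R n (S k))%E.
  apply: contrapT => H; apply: On0.
  have nS : (surface R n).-negligible (\bigcup_k S k).
    apply: negligible_bigcup => k; apply/negligibleP => //.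
    apply/eqP; rewrite eq_le measure_ge0 andbT leNgt; apply/negP => h.
    by apply: H; exists k.
  have := negligibleU O0 nS; apply: negligibleS => t /= /not_implyP[St Ot].
  have [Opos|/negP] := boolP (0 < Omega t).
    right; have [k kP] : exists k : nat, k.+1%:R^-1 < Omega t.
      have [k _ hk] := near_infty_natSinv_lt (PosNum Opos).
      by exists k; exact: (hk k (leqnn _)).
    by exists k => //; split; [split; [exact: St.1|rewrite /= in_itv/= kP]|exact: St.2].
  by move=> nO; left => /(_ St) O0t; apply: nO; rewrite lt_neqAle O0t andbT eq_sym; exact/eqP.
(* [S k] is measurable only for the completed surface measure; the cone over a Borel subset of the
   same measure is Borel. *)
have [B [mB BS BE]] := caratheodory_inner borel_surface_fin (mS k).
have cB : (0 < mu (cone B))%E.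
  have : (0 < borel_surface B)%E by rewrite BE.
  rewrite /borel_surface => h; rewrite lt0e measure_ge0 andbT; apply/negP => /eqP c0.
  by rewrite c0 mule0 ltxx in h.
(* Removing a small ball around the origin leaves positive volume for some [j]. *)
pose C j := cone B `&` [set x | enorm x \in `]j.+1%:R^-1, +oo[].
have mC j : measurable (C j).
  by apply: measurableI; [exact: measurable_cone|exact: measurable_enorm_itv].
have [j Cj] : exists j, (0 < mu (C j))%E.
  apply: contrapT => H.
  have : mu.-negligible (cone B).
    apply: (@negligibleS _ _ _ mu (\bigcup_j C j)).
      move=> x cx; have [/andP[x0 _] _] := cx.
      have [j _ hj] := near_infty_natSinv_lt (PosNum x0).
      by exists j => //; split=> //; rewrite /= in_itv/= andbT; exact: (hj j (leqnn _)).
    apply: negligible_bigcup => j; apply/negligibleP => //.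
    apply/eqP; rewrite eq_le measure_ge0 andbT leNgt; apply/negP => h.
    by apply: H; exists j.
  by move/negligibleP => /(_ (measurable_cone mB)) E; rewrite E ltxx in cB.
have j0 : 0 < j.+1%:R^-1 :> R by rewrite invr_gt0.
have k0 : 0 < k.+1%:R^-1 :> R by rewrite invr_gt0.
have CV : C j `<=` open_sector U j.+1%:R^-1.
  move=> x [[/andP[x0 x1] Bx]] /=; rewrite in_itv /= andbT => xj.
  by split; [rewrite xj x1|have [] := BS _ Bx].
have [z [l [l0 zV zC]]] :=
  dyadic_density (open_sector_open (ltW j0) oU) (mC j) CV Cj eta0.
(* One [eps] bounds from below both the norm on the cube and [Omega] on [C j]. *)
exists z, l, (Num.min j.+1%:R^-1 k.+1%:R^-1), (C j), (cone W); split.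
- exact: l0.
- by rewrite lt_min j0 k0.
- split; first exact: mC.
  by split; [exact: measurable_cone|exact: borel_surface_cone].
- exact: zC.
split.
- by move=> x /zV[/andP[x1 x2] _]; rewrite gt_min x1 x2.
- move=> x [[_ /BS[[_ +] _]] _]; rewrite /= in_itv/= andbT => h.
  by rewrite gt_min h orbT.
- move=> x /zV[/andP[x1 x2] Ux] nW.
  have x0 : 0 < enorm x by exact: lt_trans x1.
  apply: contrapT => nO; apply: nW; split; first by rewrite x0 x2.
  apply: NW => /= H; apply: nO; apply: H; split => //.
  exact: enorm_dir.
Qed.

End sector.

(** * Cubes and medians *)

Section lebesgue_facts.
Context (R : realType) (n : nat).
Implicit Types (A B D K : set 'rV[R]_n).
Local Notation lambda := (lebesgue R n).

Lemma lebesgue_measurable A : measurable A -> measurable (A : set (rvL R n)).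
Proof. by move=> mA; exact: caratheodory_measurable_mu_ext. Qed.

Lemma lebesgueE A : measurable A -> lambda A = borel_lebesgue R n A.
Proof. by move=> mA; rewrite /lebesgue /completed_measure_extension measurable_mu_extE. Qed.

Lemma lebesgue_cube (a : 'rV[R]_n) l : 0 <= l -> lambda (cube a l) = (l ^+ n)%:E.
Proof.
by move=> l0; rewrite lebesgueE; [exact: borel_lebesgue_cube|exact: measurable_cube].
Qed.

Lemma lebesgue_measurable_cube (a : 'rV[R]_n) l : measurable (cube a l : set (rvL R n)).
Proof. by apply: lebesgue_measurable; exact: measurable_cube. Qed.

Lemma coord_le_norm (x : 'rV[R]_n) i : `|x ord0 i| <= `|x|.
Proof.
rewrite -[leRHS]/(mx_norm x) mx_normrE.
exact: (le_bigmax _ (fun ij => `|x ij.1 ij.2|) (ord0, i)).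
Qed.

Lemma bounded_cube (a : 'rV[R]_n) l : bounded_set (cube a l).
Proof.
exists (`|a| + `|l|); split; first exact: num_real.
move=> M aM x xc; apply: (le_trans _ (ltW aM)).
rewrite -[leLHS]/(mx_norm x) mx_normrE; apply: bigmax_le; first by rewrite addr_ge0.
move=> [i j] _ /=; rewrite (ord1 i).
have /andP[h1 h2] := xc j.
have aj := coord_le_norm a j.
have hl := ler_norm l.
have l0 : 0 <= `|l| by [].
move: aj; rewrite ler_norml => /andP[a1 a2].
by rewrite ler_norml; apply/andP; split; lra.
Qed.

Lemma closed_cube (a : 'rV[R]_n) l : closed (cube a l).
Proof.
rewrite (_ : cube a l = \bigcap_(i in [set: 'I_n])
    ((fun x : 'rV[R]_n => x ord0 i) @^-1` `[a ord0 i, a ord0 i + l])).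
  apply: closed_bigI => i _; apply: closed_comp => [x _|]; first exact: coord_continuous.
  exact: itv_closed.
by apply/seteqP; split => [x h i _|x h i]; have := h i; rewrite /= in_itv/=; auto.
Qed.

Lemma compact_cube (a : 'rV[R]_n) l : compact (cube a l).
Proof.
apply: bounded_closed_compact; last exact: closed_cube.
exact: bounded_cube.
Qed.

Lemma vol_cube (a : 'rV[R]_n) l : 0 <= l -> vol (cube a l) = l ^+ n.
Proof. by move=> l0; rewrite /vol lebesgue_cube. Qed.

End lebesgue_facts.

Section median.
Context d (T : measurableType d) (R : realType) (mu : {measure set T -> \bar R}).

(** The supremum of the levels below which [u] has at most half of the mass is a median: levels
    slightly smaller bound the mass of [u < sup S], levels slightly larger fail the bound, and both
    pass to the limit by continuity of [mu]. *)
Lemma ex_median (P : set T) (u : T -> R) : measurable P -> (mu P < +oo)%E ->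
  measurable_fun P u ->
  exists c : R,
    ((2^-1)%:E * mu P <= mu (P `&` [set x | (c <= u x)%R]))%E /\
    ((2^-1)%:E * mu P <= mu (P `&` [set x | (u x <= c)%R]))%E.
Proof.
move=> mP Poo mu_.
have m_lt c : measurable (P `&` [set x | u x < c]).
  by rewrite -preimage_itvNyo; exact: mu_.
have m_le c : measurable (P `&` [set x | u x <= c]).
  by rewrite -preimage_itvNyc; exact: mu_.
have m_ge c : measurable (P `&` [set x | c <= u x]).
  by rewrite -preimage_itvcy; exact: mu_.
have Pfin : mu P \is a fin_num by rewrite ge0_fin_numE.
(* On a null set every level would qualify and the supremum would not exist; any value is then a
   median. *)
have [P0|P0] := eqVneq (mu P) 0%E.
  by exists 0; rewrite P0 mule0; split; exact: measure_ge0.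
have Ppos : (0 < mu P)%E by rewrite lt0e P0 measure_ge0.
pose p := fine (mu P).
have pE : mu P = p%:E by rewrite fineK.
have p0 : 0 < p by rewrite -lte_fin -pE.
have hE : ((2^-1)%:E * mu P = (p / 2)%:E)%E by rewrite pE -EFinM mulrC.
rewrite hE.
pose S := [set c : R | (mu (P `&` [set x | (u x < c)%R]) <= (p / 2)%:E)%E].
have finI X : measurable (P `&` X) -> mu (P `&` X) \is a fin_num.
  move=> mX; rewrite ge0_fin_numE//; apply: le_lt_trans Poo.
  by apply: le_measure; rewrite ?inE.
have S_ex : S !=set0.
  pose F (k : nat) := P `&` [set x | u x < - k%:R].
  have F0 : \bigcap_k F k = set0.
    rewrite -subset0 => x Fx.
    have [k kP] : exists k : nat, - u x < k%:R.
      by exists (Num.truncn (- u x)).+1; exact: truncnS_gt.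
    by have [_] := Fx k Logic.I; rewrite /= => h; move: kP h; lra.
  have : mu (F k) @[k --> \oo] --> 0%E.
    rewrite -(measure0 mu) -F0; apply: nonincreasing_cvg_mu => //.
    - by rewrite -ge0_fin_numE//; exact: finI.
    - by move=> k; exact: m_lt.
    - by rewrite F0.
    - move=> a b ab; apply/subsetPset => x [Px ux]; split=> //; apply: (lt_le_trans ux).
      by rewrite lerN2 ler_nat.
  move=> /(_ [set y | (y < (p / 2)%:E)%E]) [].
    rewrite /nbhs/=; have p2 : 0 < p / 2 by rewrite divr_gt0.
    by apply: filterS (lt_nbhsl p2) => x; rewrite /= lte_fin.
  by move=> N _ /(_ N (leqnn _)) /ltW h; exists (- N%:R).
have [k Bk] : exists k : nat, ((p / 2)%:E < mu (P `&` [set x | (u x < k%:R)%R]))%E.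
  apply: contrapT => H.
  pose F (k : nat) := P `&` [set x | u x < k%:R].
  have F0 : \bigcup_k F k = P.
    apply/seteqP; split => [x [k _ []]//|x Px].
    by exists (Num.truncn (u x)).+1 => //; split => //=; exact: truncnS_gt.
  have : mu (F k) @[k --> \oo] --> mu P.
    rewrite -[X in _ --> mu X]F0; apply: nondecreasing_cvg_mu => //.
    - by move=> k; exact: m_lt.
    - by rewrite F0.
    - move=> a b ab; apply/subsetPset => x [Px ux]; split=> //; apply: lt_le_trans ux _.
      by rewrite ler_nat.
  move=> /cvge_to_le => h.
  have : (mu P <= (p / 2)%:E)%E.
    by apply: h; apply: nearW => k; rewrite leNgt; apply/negP => h'; apply: H; exists k.
  rewrite pE lee_fin => pp; clear -p0 pp; lra.
have S_ub : has_sup S.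
  split => //; exists k%:R => c Sc; rewrite leNgt; apply/negP => kc.
  move: Bk; rewrite ltNge => /negP; apply; apply: le_trans Sc.
  by apply: le_measure; rewrite ?inE// => x [Px ux]; split => //; exact: lt_trans kc.
have cplt A B : measurable A -> measurable B -> P `<=` A `|` B ->
    (mu A <= (p / 2)%:E)%E -> ((p / 2)%:E <= mu B)%E.
  move=> mA mB PAB A2; have : (mu P <= (p / 2)%:E + mu B)%E.
    apply: (@le_trans _ _ (mu A + mu B)%E); last by rewrite leeD2r.
    apply: (le_trans _ (measureU2 _ mA mB)).
    by apply: le_measure; rewrite ?inE//; exact: measurableU.
  by rewrite pE {1}[p]splitr EFinD leeD2lE.
exists (sup S); split.
- apply: (@cplt (P `&` [set x | u x < sup S])) => //.
    move=> x Px; have [h|h] := ltP (u x) (sup S); [left|right]; split => //.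
  pose F (k : nat) := P `&` [set x | u x < sup S - k.+1%:R^-1].
  have F0 : \bigcup_k F k = P `&` [set x | u x < sup S].
    apply/seteqP; split => [x [j _ [Px ux]]|x [Px ux]].
      by split => //; apply: (lt_le_trans ux); rewrite gerBl.
    have s0 : 0 < sup S - u x by rewrite subr_gt0.
    have [j _ hj] := near_infty_natSinv_lt (PosNum s0).
    exists j => //; split => //=; have /= := hj j (leqnn _).
    by rewrite ltrBrDl -ltrBrDr.
  have : mu (F k) @[k --> \oo] --> mu (P `&` [set x | u x < sup S]).
    rewrite -F0; apply: nondecreasing_cvg_mu => //.
    - by move=> j; exact: m_lt.
    - by rewrite F0.
    - move=> a b ab; apply/subsetPset => x [Px ux]; split=> //; apply: lt_le_trans ux _.
      by rewrite lerD2l lerN2 lef_pV2 ?posrE// ler_nat.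
  move=> /cvge_to_le; apply; apply: nearW => j.
  have j0 : 0 < j.+1%:R^-1 :> R by rewrite invr_gt0.
  have [c Sc cS] := sup_adherent j0 S_ub.
  apply: le_trans Sc; apply: le_measure; rewrite ?inE//; first exact: m_lt.
  by move=> x [Px ux]; split => //; exact: lt_trans cS.
- pose F (k : nat) := P `&` [set x | u x < sup S + k.+1%:R^-1].
  have F0 : \bigcap_k F k = P `&` [set x | u x <= sup S].
    apply/seteqP; split => [x Fx|x [Px ux] j _]; last first.
      by split => //; apply: (le_lt_trans ux); rewrite ltrDl invr_gt0.
    have [Px _] := Fx 0%N Logic.I; split => //=; rewrite leNgt; apply/negP => lux.
    have s0 : 0 < u x - sup S by rewrite subr_gt0.
    have [j _ hj] := near_infty_natSinv_lt (PosNum s0).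
    have /= := hj j (leqnn _); have [_ /=] := Fx j Logic.I.
    by rewrite -ltrBlDl => h1 h2; have := lt_trans h1 h2; rewrite ltxx.
  have : mu (F k) @[k --> \oo] --> mu (P `&` [set x | u x <= sup S]).
    rewrite -F0; apply: nonincreasing_cvg_mu => //.
    - by rewrite -ge0_fin_numE//; exact: finI.
    - by move=> j; exact: m_lt.
    - by rewrite F0.
    - move=> a b ab; apply/subsetPset => x [Px ux]; split=> //; apply: lt_le_trans ux _.
      by rewrite lerD2l lef_pV2 ?posrE// ler_nat.
  move=> /cvge_to_ge; apply; apply: nearW => j.
  have : ~ S (sup S + j.+1%:R^-1).
    by move=> /(sup_ubound S_ub.2); rewrite leNgt ltrDl invr_gt0 ltr0n.
  by move/negP; rewrite /S /= -ltNge => /ltW.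
Qed.

End median.

(** * Lower bounds for the kernel *)

Section kernel.
Context (R : realType) (n : nat).
Implicit Types (x y z : 'rV[R]_n).
Local Notation mu := (borel_lebesgue R n).

Lemma hom0Z (Omega : 'rV[R]_n -> R) (c : R) x : 0 < c ->
  hom0 Omega (c *: x) = hom0 Omega x.
Proof.
move=> c0; rewrite /hom0 enormZ gtr0_norm// invfM scalerA.
by rewrite mulrAC mulVf ?mul1r// gt_eqF.
Qed.

(** One density cube serves all scales, because [Omega] is homogeneous of degree zero: [kappa] and
    [M] are fixed before [a] and [l]. The sets [G] and [N] move with [x], but their measure bounds
    do not. *)
Lemma kernel_lower_bound (Omega : 'rV[R]_n -> R) (U : set 'rV[R]_n) (beta : R) :
  (0 < n)%N -> beta < n%:R ->
  measurable_fun (sphere R n : set (rvS R n)) Omega -> open U ->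
  {ae surface R n, forall t, (sphere R n `&` U) t -> 0 <= Omega t} ->
  ~ {ae surface R n, forall t, (sphere R n `&` U) t -> Omega t = 0} ->
  exists kappa M : R, [/\ 0 < kappa, 0 <= M &
  forall (a : 'rV[R]_n) (l : R), 0 < l -> exists a' : 'rV[R]_n,
  [/\ forall i, `|a' ord0 i - a ord0 i| <= M * l,
   exists2 e, 0 < e & forall x y, cube a l x -> cube a' l y -> e < enorm (x - y) &
   forall x, cube a l x -> exists G N : set 'rV[R]_n,
   [/\ measurable G, measurable N /\ mu N = 0,
     (mu (cube a' l `\` G) <= (l ^+ n / 4)%:E)%E,
     forall y, cube a' l y -> G y ->
       kappa / l `^ (n%:R - beta) <= rough_kernel Omega beta (x - y) &
     forall y, cube a' l y -> ~ N y -> 0 <= rough_kernel Omega beta (x - y)]]].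
Proof.
move=> n0 bn mO oU O0 On0.
(* Dilating the cube of side [s] to side [3 * l] turns a missing proportion [1 / (4 * 3 ^+ n)] into
   the volume [l ^+ n / 4]. *)
have eta0 : 0 < (4 * 3 ^+ n)^-1 :> R by rewrite invr_gt0 mulr_gt0// exprn_gt0.
have [z [s [eps [A [N [s0 eps0 [mA [mN N0]] zA [zE AE NE]]]]]]] :=
  sector_density n0 eta0 mO oU O0 On0.
have s3 : 0 < 3 / s by rewrite divr_gt0.
have nb : 0 < n%:R - beta by rewrite subr_gt0.
(* [kappa] combines [hom0 Omega > eps] with [enorm (x - y) <= 3 / s * l]; [M] bounds the shift
   [l + lam * z] in each coordinate. *)
exists (eps / (3 / s) `^ (n%:R - beta)), (1 + 3 / s * `|z|); split.
- by rewrite divr_gt0// powR_gt0.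
- by rewrite addr_ge0// mulr_ge0// ltW.
(* The differences [x - y] fill a closed cube of side [2 * l] with corner [lam *: z]; the side
   [3 * l] of the dilated cube leaves room for its open faces. *)
move=> a l l0; pose lam := 3 / s * l.
have lam0 : 0 < lam by rewrite mulr_gt0.
exists (\row_i (a ord0 i - l - lam * z ord0 i)).
set a' := \row_i _.
have sc x y : cube a l x -> cube a' l y -> hocube z s (lam^-1 *: (x - y)).
  move=> xa ya i; have := xa i; have := ya i; rewrite !mxE.
  move=> /andP[y1 y2] /andP[x1 x2].
  rewrite mulrC ler_pdivlMr// ltr_pdivrMr//.
  have E : (z ord0 i + s) * lam = z ord0 i * lam + 3 * l.
    by rewrite /lam; field; rewrite gt_eqF.
  by rewrite E; apply/andP; split; nra.
have xyE x y : x - y = lam *: (lam^-1 *: (x - y)).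
  by rewrite scalerA mulfV ?scale1r// gt_eqF.
split.
- move=> i; rewrite mxE.
  rewrite (_ : _ - a ord0 i = - (l + lam * z ord0 i)); last by ring.
  rewrite normrN (le_trans (ler_normD _ _))// gtr0_norm// mulrDl mul1r lerD2l.
  rewrite normrM gtr0_norm// /lam -!mulrA ler_pM2l ?invr_gt0//.
  rewrite ler_pM2l ?invr_gt0// mulrC ler_pM2r//; exact: coord_le_norm.
- exists (lam * eps); first exact: mulr_gt0.
  move=> x y xa ya; rewrite xyE enormZ gtr0_norm// ltr_pM2l//.
  by have /andP[] := zE _ (sc _ _ xa ya).
move=> x xa.
(* For fixed [x], this affine map carries [P] into the density cube, and [G] and [N] are pulled back
   along it. *)
pose phi y := lam^-1 *: x + (- lam^-1) *: y.
have phiE y : phi y = lam^-1 *: (x - y) by rewrite /phi scalerBr scaleNr.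
have lam1 : - lam^-1 != 0 by rewrite oppr_eq0 invr_eq0 gt_eqF.
exists (phi @^-1` A), (phi @^-1` N); split.
- exact: measurable_rv_affine_preimage.
- split; first exact: measurable_rv_affine_preimage.
  by rewrite borel_lebesgue_affine// N0 mule0.
- apply: (@le_trans _ _ (mu (phi @^-1` (hocube z s `\` A)))).
    apply: le_measure; rewrite ?inE.
    + apply: measurableD; first exact: measurable_cube.
      exact: measurable_rv_affine_preimage.
    + apply: measurable_rv_affine_preimage; apply: measurableD => //.
      exact: measurable_hocube.
    + by move=> y [ya nA]; split => //; rewrite phiE; exact: sc.
  rewrite borel_lebesgue_affine//; last first.
    by apply: measurableD => //; exact: measurable_hocube.
  have c0 : 0 <= (`|- lam^-1| ^+ n)^-1 by rewrite invr_ge0 exprn_ge0.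
  apply: (le_trans (lee_wpmul2l _ zA)); first by rewrite lee_fin.
  rewrite -EFinM lee_fin normrN gtr0_norm ?invr_gt0// exprVn invrK.
  rewrite /lam !exprMn exprVn le_eqVlt; apply/orP; left; apply/eqP; field.
  by rewrite !expf_neq0// gt_eqF.
- move=> y ya Ay; have h := AE _ Ay; have zz := zE _ (sc _ _ xa ya).
  rewrite /rough_kernel {1}xyE hom0Z// -phiE.
  have e1 : 0 < enorm (x - y).
    rewrite xyE enormZ gtr0_norm// mulr_gt0//.
    by case/andP: zz => + _; exact: lt_trans.
  have e2 : enorm (x - y) <= lam.
    rewrite xyE enormZ gtr0_norm// -[leRHS]mulr1 ler_pM2l// ltW//.
    by case/andP: zz.
  rewrite -mulrA -invfM -powRM ?(ltW s3) ?(ltW l0)// -/lam.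
  apply: ler_pM; rewrite ?invr_ge0 ?powR_ge0 ?(ltW eps0) ?(ltW h)//.
  rewrite lef_pV2 ?posrE ?powR_gt0//.
  by apply: ge0_ler_powR; rewrite ?nnegrE ?(ltW nb) ?(ltW e1) ?(ltW lam0).
- move=> y ya nN; rewrite /rough_kernel {1}xyE hom0Z//.
  apply: divr_ge0; last exact: powR_ge0.
  by apply: NE; [exact: sc|move: nN; rewrite /= phiE].
Qed.

Lemma hom0N (Omega : 'rV[R]_n -> R) x : hom0 (fun t => - Omega t) x = - hom0 Omega x.
Proof. by []. Qed.

Lemma rough_kernelN (Omega : 'rV[R]_n -> R) beta x :
  rough_kernel (fun t => - Omega t) beta x = - rough_kernel Omega beta x.
Proof. by rewrite /rough_kernel hom0N mulNr. Qed.

End kernel.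

Section integral_lower_bound.
Context d (T : measurableType d) (R : realType) (mu : {measure set T -> \bar R}).

(** Applied with [S] the good part of [F]: away from [S] only the sign of [h] is used. *)
Lemma integral_ge_const (h : T -> R) (N S : set T) (k : R) :
  mu.-integrable setT (EFin \o h) -> measurable N -> mu N = 0 -> measurable S ->
  0 <= k -> (forall y, ~ N y -> 0 <= h y) -> (forall y, S y -> ~ N y -> k <= h y) ->
  (k%:E * mu S <= \int[mu]_y (h y)%:E)%E.
Proof.
move=> ih mN N0 mS k0 h0 hk.
have mnN : measurable (~` N) by exact: measurableC.
have mh : measurable_fun setT h by apply/measurable_EFinP; exact: measurable_int ih.
rewrite (negligible_integral _ _ _ N0)//= setTD.
apply: (@le_trans _ _ (\int[mu]_(y in ~` N) (k * \1_S y)%:E)%E); last first.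
  apply: ge0_le_integral => //.
  - by move=> y _; rewrite lee_fin mulr_ge0.
  - by apply/measurable_EFinP; apply: measurable_funM.
  - by apply/measurable_EFinP; exact: measurable_funTS.
  - move=> y Ny; rewrite lee_fin indicE; have [yS|yS] := boolP (y \in S).
      by rewrite mulr1; apply: hk => //; rewrite -in_setE.
    by rewrite mulr0; exact: h0.
under eq_integral do rewrite EFinM.
rewrite ge0_integralZl//; last first.
  by apply/measurable_EFinP; exact: measurable_funTS.
rewrite integral_indic//.
rewrite (_ : mu (S `&` ~` N) = mu S)//.
have E : mu S = (mu (S `&` N) + mu (S `\` N))%E.
  by rewrite -measureU// ?setUIDK//; [exact: measurableI|exact: measurableD|
    rewrite setDE setIACA setICr setI0].
rewrite E setDE (_ : mu (S `&` N) = 0%E) ?add0e//.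
apply/eqP; rewrite eq_le measure_ge0 andbT -N0.
by apply: le_measure; rewrite ?inE//; exact: measurableI.
Qed.

End integral_lower_bound.

(** * Lower bounds for the commutator *)

Section commutator.
Context (R : realType) (n : nat).
Implicit Types (x y z : 'rV[R]_n) (F : set 'rV[R]_n).
Local Notation lambda := (lebesgue R n).

(** Choosing the part by a boolean lets one argument serve for the real and the imaginary part of
    [b]. *)
Definition cpart (c : bool) (z : R[i]) : R := if c then complex.Re z else complex.Im z.

Lemma cpart_scale c (z : R[i]) (k : R) : cpart c (z * k%:C%C) = cpart c z * k.
Proof. by case: z => r s; case: c => /=; rewrite mulr0 ?subr0 ?add0r. Qed.

Lemma cpart_le_normc c (z : R[i]) : `|cpart c z| <= Normc.normc z.
Proof.
case: z => r s; case: c; rewrite /= -sqrtr_sqr; apply: ler_wsqrtr.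
  by rewrite lerDl sqr_ge0.
by rewrite lerDr sqr_ge0.
Qed.

Lemma measurable_far x (e : R) : measurable [set y : 'rV[R]_n | e < enorm (x - y)].
Proof.
have := measurable_rv_affine_preimage x (-1) (@measurable_enorm_itv R n `]e, +oo[).
congr measurable; apply/seteqP.
by split => y /=; rewrite in_itv/= andbT scaleN1r.
Qed.

Lemma cpart_integrand c Omega beta b m F x y :
  cpart c (iter_comm_integrand Omega beta b m (cindic F) x y) =
  cpart c ((b x - b y) ^+ m) * rough_kernel Omega beta (x - y) * \1_F y :> R.
Proof. by rewrite /iter_comm_integrand /cindic !cpart_scale. Qed.

(* Away from [x] the principal value is an ordinary integral: the truncated
   integrals are eventually constant. *)
Lemma iter_comm_away (Omega : 'rV[R]_n -> R) (beta : R) b m F x e c : 0 < e ->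
  (forall y, F y -> e < enorm (x - y)) ->
  iter_comm_defined Omega beta b m (cindic F) x ->
  lambda.-integrable setT (fun y =>
    (cpart c (iter_comm_integrand Omega beta b m (cindic F) x y))%:E) /\
  cpart c (iter_comm Omega beta b m (cindic F) x) =
  \int[lambda]_y cpart c (iter_comm_integrand Omega beta b m (cindic F) x y).
Proof.
move=> e0 eF; rewrite /iter_comm_defined /iter_comm; case: ifPn => _; last first.
  by rewrite /cintegrable /cintegral; case: c => -[].
set h := fun y => cpart c (iter_comm_integrand Omega beta b m (cindic F) x y).
move=> [H _ _].
pose D e' := [set y | e' < enorm (x - y)].
have mD e' : measurable (D e' : set (rvL R n)).
  by apply: lebesgue_measurable; exact: measurable_far.
have hD e' : e' <= e -> (EFin \o h) \_ (D e') = EFin \o h.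
  move=> e'e; apply/funext => y; rewrite /patch; case: ifPn => // yD.
  rewrite /h /= cpart_integrand indicE memNset ?mulr0// => Fy.
  by move: yD; rewrite notin_setE; apply; apply: le_lt_trans (eF _ Fy).
split.
  have hi : lambda.-integrable (D e) (EFin \o h).
    by have [hre him] := H e e0; rewrite /h; case: (c) => //; exact: him.
  have := (integrable_mkcond _ (mD e)).1 hi.
  by rewrite (hD e (lexx e)).
have tr e' : e' <= e ->
    cpart c (iter_comm_truncated Omega beta b m (cindic F) x e') = \int[lambda]_y h y.
  move=> e'e; transitivity (\int[lambda]_(y in D e') h y).
    by rewrite /h /iter_comm_truncated /cintegral; case: (c).
  by rewrite /Rintegral integral_mkcond hD.
have near_e : \forall e' \near 0^'+, e' <= e.
  by apply: nbhs_right_le.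
case: c @h hD tr => h hD tr /=; apply: lim_near_cst; try exact: norm_hausdorff.
  by near=> e'; apply: tr; near: e'.
by near=> e'; apply: tr; near: e'.
Unshelve. all: by end_near. Qed.

(** The sign [sg] makes the integrand nonnegative almost everywhere on [F], so the part [c] of the
    commutator is at least what [G] contributes to it. The hypothesis on [u] covers either part of
    [b] when [m = 1], and the real part of a real-valued [b] otherwise. *)
Lemma iter_comm_ge (Omega : 'rV[R]_n -> R) (beta : R) b m F G N x e c (sg k : R)
    (u : 'rV[R]_n -> R) :
  0 < e -> (forall y, F y -> e < enorm (x - y)) ->
  iter_comm_defined Omega beta b m (cindic F) x ->
  measurable (F : set (rvL R n)) -> measurable (G : set (rvL R n)) ->
  measurable (N : set (rvL R n)) -> lambda N = 0%E -> `|sg| = 1 -> 0 <= k ->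
  (forall y, cpart c ((b x - b y) ^+ m) = (u x - u y) ^+ m) ->
  (forall y, F y -> ~ N y ->
    0 <= sg * ((u x - u y) ^+ m * rough_kernel Omega beta (x - y))) ->
  (forall y, F y -> G y ->
    k <= sg * ((u x - u y) ^+ m * rough_kernel Omega beta (x - y))) ->
  (k%:E * lambda (F `&` G) <=
    (Normc.normc (iter_comm Omega beta b m (cindic F) x))%:E)%E.
Proof.
move=> e0 eF def mF mG mN N0 sg1 k0 bu h0 hk.
have [ih hE] := iter_comm_away c e0 eF def.
set h := fun y => cpart c (iter_comm_integrand Omega beta b m (cindic F) x y) in ih hE.
have E y : h y = (u x - u y) ^+ m * rough_kernel Omega beta (x - y) * \1_F y.
  by rewrite /h cpart_integrand bu.
have ish : lambda.-integrable setT (EFin \o (fun y => sg * h y)).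
  have := integrableZl measurableT sg ih.
  by apply: eq_integrable => // y _; rewrite /= EFinM.
apply: (@le_trans _ _ (\int[lambda]_y (sg * h y)%:E)%E).
  apply: (integral_ge_const ish mN N0) => //; first exact: measurableI.
  - move=> y nN; rewrite E mulrA; have [Fy|nFy] := pselect (F y).
      by rewrite indicE mem_set// mulr1; exact: h0.
    by rewrite indicE memNset// mulr0.
  - move=> y [Fy Gy] nN; rewrite E mulrA indicE mem_set// mulr1; exact: hk.
under eq_integral do rewrite EFinM.
rewrite integralZl//.
have -> : (\int[lambda]_y (h y)%:E)%E = (\int[lambda]_y h y)%:E.
  by rewrite /Rintegral fineK//; exact: integrable_fin_num.
rewrite -EFinM -hE lee_fin (le_trans (ler_norm _))// normrM sg1 mul1r.
exact: cpart_le_normc.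
Qed.

End commutator.

(** * Weighted estimates *)

Lemma le_poweR (R : realType) (x y : \bar R) (r : R) :
  0 <= r -> (0 <= x)%E -> (x <= y)%E -> (x `^ r <= y `^ r)%E.
Proof.
move=> r0 x0 xy; apply: gt0_ler_poweR => //; rewrite in_itv/= leey andbT//.
exact: le_trans xy.
Qed.

Section weighted.
Context d (T : measurableType d) (R : realType) (mu : {measure set T -> \bar R}).

(** Hoelder's inequality for [f] to the power [r] on [K] against the indicator of [K], with exponent
    [s / r] and its conjugate. The integrals may be infinite. *)
Lemma power_mean (f : T -> R) (E K : set T) (r s : R) : 0 < r -> r < s ->
  measurable E -> measurable K -> E `<=` K -> measurable_fun setT f ->
  (forall x, 0 <= f x) ->
  ((\int[mu]_(x in E) (f x `^ r)%:E) `^ r^-1 <=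
   (\int[mu]_(x in K) (f x `^ s)%:E) `^ s^-1 * mu K `^ (r^-1 - s^-1))%E.
Proof.
move=> r0 rs mE mK EK mf f0; have s0 : 0 < s by exact: lt_trans rs.
have mfr t : measurable_fun setT (fun x => f x `^ t).
  exact: (measurableT_comp (measurable_powR t) mf).
pose g x := f x `^ r * \1_K x.
have mg : measurable_fun setT g by apply: measurable_funM.
pose P := s / r; pose Q := (1 - r / s)^-1.
have rs1 : r / s < 1 by rewrite ltr_pdivrMr// mul1r.
have P0 : 0 < P by rewrite divr_gt0.
have Q0 : 0 < Q by rewrite invr_gt0 subr_gt0.
have PQ : P^-1 + Q^-1 = 1 by rewrite /P /Q invrK invf_div addrC subrK.
have Qi : Q^-1 = 1 - r / s by rewrite invrK.
have mI : measurable_fun setT (\1_K : T -> R) by exact: measurable_indic.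
have := hoelder mu mg mI P0 Q0 PQ.
rewrite Lnorm1 unlock /=.
have -> : (\int[mu]_x (`|(\1_K x : R)| `^ Q)%:E)%E = mu K.
  transitivity (\int[mu]_x (\1_K x)%:E)%E; last by rewrite integral_indic// setIT.
  apply: eq_integral => x _.
  rewrite indicE; case: (x \in K); rewrite /= ?normr1 ?powR1// normr0 powR0//.
  by rewrite gt_eqF.
have -> : (\int[mu]_x (`|g x| `^ P)%:E)%E = (\int[mu]_(x in K) (f x `^ s)%:E)%E.
  rewrite [RHS]integral_mkcond; apply: eq_integral => x _.
  rewrite /patch /g indicE; case: ifPn => xK; rewrite /= ?mulr1 ?mulr0.
    by rewrite ger0_norm ?powR_ge0// -powRrM /P mulrC divfK// gt_eqF.
  by rewrite normr0 powR0// gt_eqF.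
move=> H.
have H1 : (\int[mu]_(x in E) (f x `^ r)%:E <=
    (\int[mu]_(x in K) (f x `^ s)%:E) `^ P^-1 * mu K `^ Q^-1)%E.
  apply: le_trans H; rewrite [leLHS]integral_mkcond.
  apply: ge0_le_integral => //.
  - by move=> x _; rewrite /patch; case: ifPn => // _; rewrite lee_fin powR_ge0.
  - apply/(measurable_restrictT _ _).1 => //; apply/measurable_EFinP.
    exact: measurable_funTS.
  - apply/measurable_EFinP; apply: measurableT_comp => //.
    by apply: measurable_funM.
  - move=> x _; rewrite /patch; case: ifPn => [xE|_]; last by rewrite lee_fin.
    rewrite /g indicE mem_set /=; last by apply: EK; rewrite -in_setE.
    by rewrite !mulr1 lee_fin ler_norm.
have I0 X t : (0 <= \int[mu]_(x in X) (f x `^ t)%:E)%E.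
  by apply: integral_ge0 => y _; rewrite lee_fin powR_ge0.
have ri0 : 0 <= r^-1 by rewrite invr_ge0 ltW.
have := le_poweR ri0 (I0 _ _) H1.
rewrite poweRM ?poweR_ge0// -!poweRrM.
rewrite (_ : P^-1 * r^-1 = s^-1); last by rewrite /P invf_div mulrAC mulfV ?mul1r// gt_eqF.
rewrite (_ : Q^-1 * r^-1 = r^-1 - s^-1)//.
by rewrite Qi mulrBl mul1r mulrAC mulfV ?mul1r// gt_eqF.
Qed.

(** The integral of a nonnegative function is a supremum over the simple functions below it, hence
    monotone with no measurability. This is what allows the commutator as an integrand. *)
Lemma ge0_le_integral_nonmeasurable (D : set T) (f g : T -> \bar R) :
  (forall x, D x -> (0 <= f x)%E) -> (forall x, D x -> (f x <= g x)%E) ->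
  (\int[mu]_(x in D) f x <= \int[mu]_(x in D) g x)%E.
Proof.
move=> f0 fg; rewrite [leLHS]integral_mkcond [leRHS]integral_mkcond.
have F0 x : (0 <= (f \_ D) x)%E by exact: erestrict_ge0.
have FG x : ((f \_ D) x <= (g \_ D) x)%E by exact: lee_restrict.
have G0 x : (0 <= (g \_ D) x)%E by exact: le_trans (FG x).
rewrite !ge0_integralTE//; apply: le_ereal_sup => _ [h hf <-].
by exists h => // x; exact: le_trans (FG x).
Qed.

End weighted.

Lemma powR_expR (R : realType) (x r : R) : 0 < x -> x `^ r = expR (r * ln x).
Proof. by move=> x0; rewrite /powR gt_eqF. Qed.

Section weighted_bound.
Context d (T : measurableType d) (R : realType) (mu : {measure set T -> \bar R}).

Lemma eq_integral_off (N D : set T) (f g : T -> \bar R) :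
  measurable N -> mu N = 0%E -> measurable D ->
  measurable_fun (setT ) f -> measurable_fun (setT ) g ->
  (forall x, 0 <= f x)%E -> (forall x, 0 <= g x)%E ->
  (forall x, ~ N x -> f x = g x) ->
  (\int[mu]_(x in D) f x = \int[mu]_(x in D) g x)%E.
Proof.
move=> mN N0 mD mf mg f0 g0 fg.
have mf' : measurable_fun D f by exact: measurable_funTS.
have mg' : measurable_fun D g by exact: measurable_funTS.
rewrite (ge0_negligible_integral mN mD mf' (fun x _ => f0 x) N0).
rewrite (ge0_negligible_integral mN mD mg' (fun x _ => g0 x) N0).
by apply: eq_integral => x; rewrite inE => -[_ nN]; exact: fg.
Qed.

Lemma regroup_mule (e c k kk : R) (X Y : \bar R) : (e * (c * k) = kk)%R ->
  (kk%:E * (X * Y) = e%:E * ((c%:E * X) * (k%:E * Y)))%E.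
Proof. by move=> <-; rewrite [((c%:E * X) * (k%:E * Y))%E]muleACA [RHS]muleA -!EFinM. Qed.

(* The exponent comes from [1 + 1/p - 1/q = 1/q + 1/p' + 2 (1/p - 1/q)]. *)
Lemma weighted_bound (p q C W V : R) (w G g : T -> R) (E F K : set T) :
  1 < p -> 1 < q -> p < q -> 0 < V -> measurable_fun setT w ->
  {ae mu, forall x, 0 < w x} ->
  measurable K -> mu K = V%:E ->
  ((V^-1%:E * \int[mu]_(x in K) (w x `^ q)%:E) `^ q^-1 *
   (V^-1%:E * \int[mu]_(x in K) (w x `^ (- (1 - p^-1)^-1))%:E)
      `^ (1 - p^-1)^-1^-1 <= W%:E)%E ->
  measurable E -> measurable F -> E `<=` K -> F `<=` K ->
  measurable_fun setT G -> (forall x, 0 <= G x) ->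
  (forall x, ~ E x -> G x = 0) ->
  {ae mu, forall x, G x <= g x} -> (forall x, 0 <= g x) -> 0 <= C ->
  ((\int[mu]_x (g x `^ q * w x `^ q)%:E) `^ q^-1 <=
    C%:E * (\int[mu]_(x in F) (w x `^ p)%:E) `^ p^-1)%E ->
  (\int[mu]_x (G x)%:E <= (C * W * V `^ (1 + (p^-1 - q^-1)))%:E)%E.
Proof.
move=> p1 q1 pq V0 mw w_gt0 mK KV Ach mE mF EK FK mG G0 GE aeG g0 C0 hg.
have p0 : 0 < p by exact: lt_trans p1.
have q0 : 0 < q by exact: lt_trans q1.
pose p' := (1 - p^-1)^-1; pose q' := (1 - q^-1)^-1.
have ip1 : p^-1 < 1 by rewrite invf_lt1.
have iq1 : q^-1 < 1 by rewrite invf_lt1.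
have iqp : q^-1 < p^-1 by rewrite ltf_pV2.
have p'0 : 0 < p' by rewrite invr_gt0 subr_gt0.
have q'0 : 0 < q' by rewrite invr_gt0 subr_gt0.
have q'p' : q' < p' by rewrite ltf_pV2 ?posrE ?subr_gt0// ltrD2l ltrN2.
(* A single null set outside which the weight is positive and [G <= g]. *)
have [N [mN N0 sN]] := negligibleU w_gt0 aeG.
have offN x : ~ N x -> 0 < w x /\ G x <= g x.
  move=> nN; apply: contrapT => h; apply: nN; apply: sN.
  apply: contrapT => /not_orP[h1 h2]; apply: h.
  by split; [exact: (contrapT h1)|exact: (contrapT h2)].
(* Setting the weight to 1 and [G] to 0 on [N] changes no integral and makes division by the weight
   legitimate everywhere. *)
pose w0 x := w x * \1_(~` N) x + \1_N x.
pose G1 x := G x * \1_(~` N) x.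
have mnN : measurable (~` N) by exact: measurableC.
have mw0 : measurable_fun (setT ) w0.
  by apply: measurable_funD => //; apply: measurable_funM.
have mG1 : measurable_fun (setT ) G1 by apply: measurable_funM.
have w0N x : N x -> w0 x = 1.
  by move=> Nx; rewrite /w0 !indicE memNset ?mulr0 ?add0r ?mem_set//= => /(_ Nx).
have w0nN x : ~ N x -> w0 x = w x.
  by move=> Nx; rewrite /w0 !indicE mem_set ?memNset//= mulr1 addr0.
have G1N x : N x -> G1 x = 0.
  by move=> Nx; rewrite /G1 indicE memNset ?mulr0//= => /(_ Nx).
have G1nN x : ~ N x -> G1 x = G x.
  by move=> Nx; rewrite /G1 indicE mem_set//= mulr1.
have w0_gt0 x : 0 < w0 x.
  have [Nx|Nx] := pselect (N x); first by rewrite w0N.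
  by rewrite w0nN//; have [] := offN _ Nx.
have G1_ge0 x : 0 <= G1 x by rewrite mulr_ge0.
have mpow (f : T -> R) r : measurable_fun (setT ) f ->
    measurable_fun (setT ) (fun x => (f x `^ r)%:E).
  by move=> mf; apply/measurable_EFinP; exact: (measurableT_comp (measurable_powR r) mf).
have wE (D ) r : measurable D ->
    (\int[mu]_(x in D) (w x `^ r)%:E = \int[mu]_(x in D) (w0 x `^ r)%:E)%E.
  move=> mD; apply: (eq_integral_off mN N0) => //; try exact: mpow;
    try by move=> x; rewrite lee_fin powR_ge0.
  by move=> x Nx; rewrite w0nN.
have -> : (\int[mu]_x (G x)%:E = \int[mu]_x (G1 x)%:E)%E.
  apply: (eq_integral_off mN N0 measurableT).
  - by apply/measurable_EFinP.
  - by apply/measurable_EFinP.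
  - by move=> x; rewrite lee_fin.
  - by move=> x; rewrite lee_fin.
  - by move=> x Nx; rewrite G1nN.
pose w1 x := (w0 x)^-1.
have w1_gt0 x : 0 < w1 x by rewrite invr_gt0.
have w1E x r : w1 x `^ r = w0 x `^ (- r).
  by rewrite /w1 -powR_inv1 ?ltW// -powRrM mulN1r.
have mw1 : measurable_fun (setT ) w1.
  rewrite (_ : w1 = fun x => w0 x `^ (- 1)).
    exact: (measurableT_comp (measurable_powR (-1)) mw0).
  by apply/funext => x; rewrite powR_inv1// ltW.
(* Hoelder with exponents [q] and [q']: the weight goes to [G1], its inverse to the indicator of
   [E]. *)
pose f1 x := G1 x * w0 x; pose f2 x := w1 x * \1_E x.
have mf1 : measurable_fun (setT ) f1 by exact: measurable_funM.
have mf2 : measurable_fun (setT ) f2 by apply: measurable_funM.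
have qq' : q^-1 + q'^-1 = 1 by rewrite /q' invrK addrC subrK.
have := hoelder mu mf1 mf2 q0 q'0 qq'.
rewrite Lnorm1 unlock /=.
have -> : (\int[mu]_x `|(f1 x * f2 x)%:E| = \int[mu]_x (G1 x)%:E)%E.
  apply: eq_integral => x _ /=; rewrite /f1 /f2 /w1 indicE.
  have [Ex|nEx] := pselect (E x).
    by rewrite mem_set// mulr1 mulfK ?gt_eqF// ger0_norm.
  by rewrite memNset// !mulr0 normr0 /G1 GE// mul0r.
have -> : (\int[mu]_x (`|f2 x| `^ q')%:E = \int[mu]_(x in E) (w1 x `^ q')%:E)%E.
  rewrite [RHS]integral_mkcond; apply: eq_integral => x _.
  rewrite /patch /f2 indicE; case: ifPn => xE; rewrite ?mulr1 ?mulr0.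
    by rewrite gtr0_norm.
  by rewrite normr0 powR0// gt_eqF.
have hq1 : ((\int[mu]_x (`|f1 x| `^ q)%:E) `^ q^-1 <= (\int[mu]_x (g x `^ q * w x `^ q)%:E) `^ q^-1)%E.
  have iq0 : 0 <= q^-1 by rewrite invr_ge0 ltW.
  have le_int : (\int[mu]_x (`|f1 x| `^ q)%:E <=
      \int[mu]_x (g x `^ q * w x `^ q)%:E)%E.
    apply: ge0_le_integral_nonmeasurable => x _; first by rewrite lee_fin powR_ge0.
    rewrite lee_fin /f1 ger0_norm ?mulr_ge0 ?(ltW (w0_gt0 x))//.
    have [Nx|Nx] := pselect (N x).
      by rewrite G1N// mul0r powR0 ?gt_eqF// mulr_ge0 ?powR_ge0.
    rewrite G1nN// w0nN//; have [wx Gx] := offN _ Nx.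
    rewrite powRM ?(ltW wx)// ler_pM2r ?powR_gt0//.
    apply: ge0_ler_powR; rewrite ?nnegrE ?(ltW q0)//.
  apply: le_poweR iq0 _ le_int.
  by apply: integral_ge0 => y _; rewrite lee_fin powR_ge0.
(* The exponents are raised to those of the [A_{p,q}] condition on [K]: [q'] to [p'] for the inverse
   weight on [E], [p] to [q] for the weight on [F]. *)
have hq2 := power_mean mu q'0 q'p' mE mK EK mw1 (fun x => ltW (w1_gt0 x)).
have hp2 := power_mean mu p0 pq mF mK FK mw0 (fun x => ltW (w0_gt0 x)).
rewrite KV poweR_EFin in hq2 hp2.
set X := ((\int[mu]_(x in K) (w0 x `^ q)%:E) `^ q^-1)%E in hp2.
set Y := ((\int[mu]_(x in K) (w1 x `^ p')%:E) `^ p'^-1)%E in hq2.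
have X0 : (0 <= X)%E by exact: poweR_ge0.
have Y0 : (0 <= Y)%E by exact: poweR_ge0.
have {Ach} Ach : (((V^-1) `^ q^-1)%:E * X * (((V^-1) `^ p'^-1)%:E * Y) <= W%:E)%E.
  apply: le_trans Ach; rewrite -/p'.
  have V1 : (0 <= (V^-1)%:E)%E by rewrite lee_fin invr_ge0 ltW.
  have I0 f (r : R) : (0 <= \int[mu]_(x in K) (f x `^ r)%:E)%E.
    by apply: integral_ge0 => x _; rewrite lee_fin powR_ge0.
  have YE : (Y = (\int[mu]_(x in K) (w0 x `^ (- p'))%:E) `^ p'^-1)%E.
    by rewrite /Y; congr (_ `^ _)%E; apply: eq_integral => y _; rewrite w1E.
  by rewrite !poweRM// !poweR_EFin !wE// YE.
move=> H; apply: (le_trans H).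
apply: (@le_trans _ _ ((C%:E * (X * (V `^ (p^-1 - q^-1))%:E)) *
    (Y * (V `^ (q'^-1 - p'^-1))%:E))%E).
  apply: lee_pmul; rewrite ?poweR_ge0//.
  apply: (le_trans hq1); apply: (le_trans hg); apply: lee_wpmul2l => //.
  by rewrite wE.
pose v := V `^ (p^-1 - q^-1); pose v' := V `^ (q'^-1 - p'^-1).
have -> : (C%:E * (X * v%:E) * (Y * v'%:E) = (C * v * v')%:E * (X * Y))%E.
  rewrite [(X * _)%E]muleC [(Y * _)%E]muleC !muleA -!EFinM.
  by rewrite -!muleA [(X * _)%E]muleCA !muleA -!EFinM.
pose c1 := V^-1 `^ q^-1; pose c2 := V^-1 `^ p'^-1.
have c10 : 0 < c1 by rewrite powR_gt0 ?invr_gt0.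
have c20 : 0 < c2 by rewrite powR_gt0 ?invr_gt0.
have v0 : 0 <= v by exact: powR_ge0.
have v'0 : 0 <= v' by exact: powR_ge0.
rewrite (@regroup_mule (C * v * v' / (c1 * c2)) c1 c2); last first.
  by field; rewrite !gt_eqF.
have e0 : 0 <= C * v * v' / (c1 * c2).
  by rewrite divr_ge0 ?mulr_ge0// ltW.
apply: (le_trans (lee_wpmul2l _ Ach)); first by rewrite lee_fin.
rewrite -EFinM lee_fin.
suff -> : C * v * v' / (c1 * c2) = C * V `^ (1 + (p^-1 - q^-1)).
  by rewrite le_eqVlt mulrAC eqxx.
rewrite -!mulrA; congr (_ * _).
rewrite /v /v' /c1 /c2 !powR_expR ?invr_gt0// lnV ?posrE// -expRD -expRN -!expRD.
by congr expR; rewrite /p' /q' !invrK; ring.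
Qed.

End weighted_bound.

(** * Oscillation on one side of the median *)

Section measurable_oscillation.
Context d (T : measurableType d) (R : realType) (u : T -> R).
Hypothesis mu_ : measurable_fun setT u.

Let measurable_nneg (f : T -> R) : measurable_fun setT f -> measurable [set y | 0 <= f y].
Proof.
move=> mf; have := mf measurableT _ (measurable_itv `[0, +oo[).
rewrite setTI; congr measurable.
by apply/seteqP; split => y /=; rewrite in_itv/= andbT.
Qed.

Lemma measurable_upper_half (s c : R) : measurable [set y | 0 <= s * (u y - c)].
Proof.
by apply: measurable_nneg; apply: measurable_funM => //; apply: measurable_funB.
Qed.

Lemma measurable_lower_half (s c : R) : measurable [set y | 0 <= s * (c - u y)].
Proof.
by apply: measurable_nneg; apply: measurable_funM => //; apply: measurable_funB.
Qed.

Lemma measurable_oscX (c : R) m : measurable_fun setT (fun x => `|u x - c| ^+ m).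
Proof.
by apply: measurable_funX; apply: measurableT_comp => //; apply: measurable_funB.
Qed.

Lemma measurable_osc_indic (k c : R) m (E : set T) : measurable E ->
  measurable_fun setT (fun x => k * (`|u x - c| ^+ m * \1_E x)).
Proof.
move=> mE; apply: measurable_funM => //; apply: measurable_funM => //.
exact: measurable_oscX.
Qed.

Lemma integral_osc_indic (mu : {measure set T -> \bar R}) (k c : R) m (E : set T) :
  0 <= k -> measurable E ->
  (\int[mu]_x (k * (`|u x - c| ^+ m * \1_E x))%:E =
    k%:E * \int[mu]_(x in E) (`|u x - c| ^+ m)%:E)%E.
Proof.
move=> k0 mE; rewrite [in RHS]integral_mkcond -ge0_integralZl//.
- apply: eq_integral => x _; rewrite /patch indicE EFinM.
  by case: ifPn => xE; rewrite ?mulr1// ?mulr0 mule0.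
- apply/(measurable_restrictT _ _).1 => //; apply/measurable_EFinP.
  by apply: measurable_funTS; exact: measurable_oscX.
- by move=> x _; rewrite /patch; case: ifPn => // _; rewrite lee_fin exprn_ge0.
Qed.

End measurable_oscillation.

(** * The basic estimate on a pair of cubes *)

Section assembly.
Context (R : realType) (n : nat).
Local Notation lambda := (lebesgue R n).

Lemma signed_kernel_lower_bound (Omega : 'rV[R]_n -> R) (beta : R) :
  (0 < n)%N -> beta < n%:R ->
  measurable_fun (sphere R n : set (rvS R n)) Omega ->
  (exists U : set 'rV[R]_n, [/\ open U,
      {ae surface R n, forall t, (sphere R n `&` U) t -> 0 <= Omega t} \/
      {ae surface R n, forall t, (sphere R n `&` U) t -> Omega t <= 0} &
      ~ {ae surface R n, forall t, (sphere R n `&` U) t -> Omega t = 0}]) ->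
  exists tau kappa M : R, [/\ `|tau| = 1, 0 < kappa, 0 <= M &
  forall (a : 'rV[R]_n) (l : R), 0 < l -> exists a' : 'rV[R]_n,
  [/\ forall i, `|a' ord0 i - a ord0 i| <= M * l,
   exists2 e, 0 < e & forall x y, cube a l x -> cube a' l y -> e < enorm (x - y) &
   forall x, cube a l x -> exists G N : set 'rV[R]_n,
   [/\ measurable G, measurable N /\ borel_lebesgue R n N = 0,
     (borel_lebesgue R n (cube a' l `\` G) <= (l ^+ n / 4)%:E)%E,
     forall y, cube a' l y -> G y ->
       kappa / l `^ (n%:R - beta) <= tau * rough_kernel Omega beta (x - y) &
     forall y, cube a' l y -> ~ N y -> 0 <= tau * rough_kernel Omega beta (x - y)]]].
Proof.
move=> n0 bn mO [U [oU [ O0 | O0 ] On0]].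
  have [kappa [M [k0 M0 H]]] := kernel_lower_bound n0 bn mO oU O0 On0.
  exists 1, kappa, M; split; rewrite ?normr1// => a l l0.
  have [a' [h1 h2 h3]] := H a l l0; exists a'; split => // x xa.
  have [G [N [g1 g2 g3 g4 g5]]] := h3 x xa; exists G, N.
  by split => // y ya yG; rewrite mul1r; [exact: g4|exact: g5].
have mO' : measurable_fun (sphere R n : set (rvS R n)) (fun t => - Omega t).
  exact: measurableT_comp.
have O0' : {ae surface R n, forall t, (sphere R n `&` U) t -> 0 <= - Omega t}.
  apply: negligibleS O0 => t /= nt h; apply: nt => St.
  by rewrite oppr_ge0; exact: h.
have On0' : ~ {ae surface R n, forall t, (sphere R n `&` U) t -> - Omega t = 0}.
  move=> h; apply: On0; apply: negligibleS h => t /= nt h; apply: nt => St.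
  by have /eqP := h St; rewrite oppr_eq0 => /eqP.
have [kappa [M [k0 M0 H]]] := kernel_lower_bound n0 bn mO' oU O0' On0'.
exists (-1), kappa, M; split; rewrite ?normrN1// => a l l0.
have [a' [h1 h2 h3]] := H a l l0; exists a'; split => // x xa.
have [G [N [g1 g2 g3 g4 g5]]] := h3 x xa; exists G, N.
by split => // y ya yG; rewrite mulN1r -rough_kernelN; [exact: g4|exact: g5].
Qed.

Lemma wide_cube (a a' : 'rV[R]_n) (l M : R) : 0 <= M -> 0 < l ->
  (forall i, `|a' ord0 i - a ord0 i| <= M * l) ->
  cube a l `<=` cube (\row_i (a ord0 i - M * l)) ((2 * M + 1) * l) /\
  cube a' l `<=` cube (\row_i (a ord0 i - M * l)) ((2 * M + 1) * l).
Proof.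
move=> M0 l0 aa'; have Ml0 : 0 <= M * l by rewrite mulr_ge0// ltW.
split=> x xc i; rewrite mxE; have /andP[x1 x2] := xc i.
  by apply/andP; split; lra.
have := aa' i; rewrite ler_norml => /andP[h1 h2].
by apply/andP; split; lra.
Qed.

(** The two halves of [Q] are the cases [sg = 1] and [sg = -1]. Testing the hypothesis on the
    indicator of [F] bounds the commutator from above in norm, while the absence of cancellation
    bounds it from below on [E]; [C1] does not depend on the cubes. *)
Lemma one_sided_oscillation (m : nat) (p q alpha beta C W tau kappa M : R)
    (w Omega u : 'rV[R]_n -> R) (b : 'rV[R]_n -> R[i]) (c : bool) :
  (0 < n)%N -> 1 < p -> 1 < q -> p < q ->
  q^-1 = p^-1 - (m%:R * alpha + beta) / n%:R ->
  weight w -> (forall Q, is_cube Q -> (Apq_char p q w Q <= W%:E)%E) -> 0 <= W ->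
  0 < C -> 0 < kappa -> 0 <= M -> `|tau| = 1 ->
  (forall E : set 'rV[R]_n,
      bounded_set E -> measurable (E : set (rvL R n)) ->
      {ae lambda, forall x, iter_comm_defined Omega beta b m (cindic E) x} /\
      (wLnorm q w (iter_comm Omega beta b m (cindic E))
        <= C%:E * wpow_measure p w E `^ p^-1)%E) ->
  measurable_fun (setT : set (rvL R n)) u ->
  (forall x y, cpart c ((b x - b y) ^+ m) = (u x - u y) ^+ m) ->
  exists2 C1, 0 <= C1 &
  forall (a a' : 'rV[R]_n) (l e c0 sg : R), 0 < l -> 0 < e ->
   (forall i, `|a' ord0 i - a ord0 i| <= M * l) ->
   (forall x y, cube a l x -> cube a' l y -> e < enorm (x - y)) ->
   (forall x, cube a l x -> exists G N : set 'rV[R]_n,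
     [/\ measurable G, measurable N /\ borel_lebesgue R n N = 0,
     (borel_lebesgue R n (cube a' l `\` G) <= (l ^+ n / 4)%:E)%E,
     forall y, cube a' l y -> G y ->
       kappa / l `^ (n%:R - beta) <= tau * rough_kernel Omega beta (x - y) &
     forall y, cube a' l y -> ~ N y -> 0 <= tau * rough_kernel Omega beta (x - y)]) ->
   sg = 1 \/ sg = -1 ->
   ((2^-1 * l ^+ n)%:E <= lambda (cube a' l `&` [set y | (0 <= sg * (c0 - u y))%R]))%E ->
   (\int[lambda]_(x in cube a l `&` [set x | (0 <= sg * (u x - c0))%R])
      (`|u x - c0| ^+ m)%:E <= (C1 * l `^ (n%:R + m%:R * alpha))%:E)%E.
Proof.
move=> n0 p1 q1 pq hpq ww Ach W0 C0 k0 M0 tau1 hT mu_ bu.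
have n0' : 0 < n%:R :> R by rewrite ltr0n.
have L0 : 0 < 2 * M + 1 by rewrite ltr_wpDl// mulr_ge0.
(* [4 / kappa] inverts the pointwise lower bound [k1]; the last factor is the volume of the enlarged
   cube [K] at unit scale, to the power given by [weighted_bound]. *)
pose C1 := C * W * 4 / kappa * (2 * M + 1) `^ (n%:R * (1 + (p^-1 - q^-1))).
exists C1; first by rewrite mulr_ge0 ?powR_ge0// divr_ge0 ?mulr_ge0// ltW.
move=> a a' l e c0 sg l0 e0 aa' eP HG sg1 hF.
set F := cube a' l `&` _ in hF; set E := cube a l `&` _.
pose K := cube (\row_i (a ord0 i - M * l)) ((2 * M + 1) * l) : set 'rV[R]_n.
have Ll0 : 0 < (2 * M + 1) * l by rewrite mulr_gt0.
have [QK PK] := wide_cube M0 l0 aa'.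
have mE : measurable (E : set (rvL R n)).
  apply: measurableI; first exact: lebesgue_measurable_cube.
  exact: measurable_upper_half.
have mF : measurable (F : set (rvL R n)).
  apply: measurableI; first exact: lebesgue_measurable_cube.
  exact: measurable_lower_half.
have bF : bounded_set F.
  have [B [Br HB]] := bounded_cube a' l.
  by exists B; split => // r Br' x [xa _]; exact: HB.
have [def hw] := hT F bF mF.
pose kap := kappa / l `^ (n%:R - beta).
have kap0 : 0 < kap by rewrite divr_gt0// powR_gt0.
have ln4 : 0 < l ^+ n / 4 by rewrite divr_gt0// exprn_gt0.
(* Lower bound of the kernel times the volume left in [F] by the exceptional set. *)
pose k1 := kap * (l ^+ n / 4).
have k10 : 0 < k1 by exact: mulr_gt0.
pose G x := k1 * (`|u x - c0| ^+ m * \1_E x).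
have mG : measurable_fun (setT : set (rvL R n)) G.
  exact: measurable_osc_indic.
have osc0 x : 0 <= `|u x - c0| ^+ m by rewrite exprn_ge0.
have G0 x : 0 <= G x.
  by rewrite mulr_ge0 ?(ltW k10)// mulr_ge0.
have GE x : ~ E x -> G x = 0.
  by move=> nE; rewrite /G indicE memNset// !mulr0.
have aeG : {ae lambda, forall x,
    G x <= Normc.normc (iter_comm Omega beta b m (cindic F) x)}.
  apply: negligibleS def => x /= nG dx; apply: nG.
  have [Ex|nE] := pselect (E x); last first.
    by rewrite GE//; apply: le_trans (cpart_le_normc true _).
  have [xQ sx] := Ex.
  have [G' [N [mG' [mN N0] PG h1 h2]]] := HG x xQ.
  have sg_norm (r : R) : `|r| = `|sg * r|.
    by rewrite normrM; case: sg1 => ->; rewrite ?normrN ?normr1 mul1r.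
  have uxc : sg * (u x - c0) = `|u x - c0| by rewrite (sg_norm (u x - c0)) ger0_norm.
  (* [c0] lies between [u y] and [u x], so replacing [c0] by [u y] only increases the distance to
     [u x]. *)
  have Fge y : F y -> `|u x - c0| <= sg * (u x - u y).
    move=> [_ /= Fy]; rewrite -uxc.
    have -> : u x - u y = (u x - c0) + (c0 - u y) by rewrite addrA subrK.
    by rewrite [leRHS]mulrDr lerDl.
  have Fpow y : F y -> `|u x - c0| ^+ m <= sg ^+ m * (u x - u y) ^+ m.
    by move=> Fy; rewrite -exprMn; apply: lerXn2r; rewrite ?nnegrE// ?Fge//;
      apply: le_trans (Fge _ Fy).
  have FPow0 y : F y -> 0 <= sg ^+ m * (u x - u y) ^+ m.
    by move=> Fy; apply: le_trans (Fpow _ Fy).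
  have := @iter_comm_ge R n Omega beta b m F G' N x e c (tau * sg ^+ m)
     (`|u x - c0| ^+ m * kap) u e0.
  move=> H; have {}H := H (fun y Fy => eP x y xQ Fy.1) dx mF
     (lebesgue_measurable mG') (lebesgue_measurable mN).
  have N0' : lambda N = 0%E by rewrite lebesgueE.
  have s1 : `|tau * sg ^+ m| = 1.
    by rewrite normrM tau1 mul1r normrX; case: sg1 => ->; rewrite ?normrN ?normr1 expr1n.
  have {}H := H N0' s1 (mulr_ge0 (osc0 x) (ltW kap0)) (bu x).
  have rE (y : 'rV[R]_n) : tau * sg ^+ m * ((u x - u y) ^+ m * rough_kernel Omega beta (x - y)) =
     (sg ^+ m * (u x - u y) ^+ m) * (tau * rough_kernel Omega beta (x - y)) by ring.
  have {}H : ((`|u x - c0| ^+ m * kap)%:E * lambda (F `&` G') <=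
    (Normc.normc (iter_comm Omega beta b m (cindic F) x))%:E)%E.
    apply: H => y Fy hy; rewrite rE.
      by apply: mulr_ge0; [exact: FPow0|exact: h2 Fy.1 hy].
    by apply: ler_pM => //; [exact: ltW|exact: Fpow|exact: h1 Fy.1 hy].
  rewrite -lee_fin; apply: le_trans H.
  have -> : G x = `|u x - c0| ^+ m * kap * (l ^+ n / 4).
    by rewrite /G indicE mem_set//= /k1; ring.
  rewrite EFinM; apply: lee_wpmul2l; first by rewrite lee_fin mulr_ge0// ltW.
  have mG'' := lebesgue_measurable mG'.
  (* Half of the cube minus a quarter leaves a quarter, whatever [x] is. *)
  have FD : ((2^-1 * l ^+ n)%:E <= lambda (F `&` G') + (l ^+ n / 4)%:E)%E.
    apply: (le_trans hF).
    apply: (@le_trans _ _ (lambda (F `&` G') + lambda (cube a' l `\` G'))%E).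
      apply: (le_trans _ (measureU2 _ _ _)).
      - apply: le_measure; rewrite ?inE//.
          apply: measurableU; first exact: measurableI.
          by apply: measurableD => //; exact: lebesgue_measurable_cube.
        move=> y Fy; have [Gy|nGy] := pselect (G' y); first by left.
        by right; split => //; exact: Fy.1.
      - exact: measurableI.
      - by apply: measurableD => //; exact: lebesgue_measurable_cube.
    rewrite leeD2l//; rewrite lebesgueE//.
    by apply: measurableD => //; exact: measurable_cube.
  rewrite -(@leeD2rE _ (l ^+ n / 4)%:E)//; apply: le_trans FD.
  by rewrite -EFinD lee_fin; have := exprn_gt0 n l0; lra.
have EK : E `<=` K by move=> x [xa _]; exact: QK.
have FK : F `<=` K by move=> x [xa _]; exact: PK.
have AK : (Apq_char p q w K <= W%:E)%E by apply: Ach; exists (\row_i (a ord0 i - M * l)), ((2 * M + 1) * l).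
have V0 : 0 < ((2 * M + 1) * l) ^+ n by rewrite exprn_gt0.
have mK : measurable (K : set (rvL R n)) by exact: lebesgue_measurable_cube.
have KV : lambda K = (((2 * M + 1) * l) ^+ n)%:E by rewrite lebesgue_cube// ltW.
have AK' := AK.
rewrite /Apq_char /eaverage vol_cube ?(ltW Ll0)// in AK'.
have := weighted_bound p1 q1 pq V0 ww.1.1 ww.2 mK KV AK' mE mF EK FK mG G0 GE aeG
  (fun x => le_trans (normr_ge0 _) (cpart_le_normc true _)) (ltW C0) hw.
rewrite /G (integral_osc_indic mu_ lambda c0 m (ltW k10) mE).
rewrite -lee_pdivlMl// => /le_trans; apply; rewrite -EFinM lee_fin.
rewrite le_eqVlt; apply/orP; left; apply/eqP.
rewrite /C1 /k1 /kap.
have -> : ((2 * M + 1) * l) ^+ n = (2 * M + 1) ^+ n * l ^+ n by rewrite exprMn.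
rewrite powRM ?exprn_ge0 ?(ltW L0) ?(ltW l0)//.
rewrite -!powR_mulrn ?(ltW L0) ?(ltW l0)// -!powRrM.
set z := (2 * M + 1) `^ _.
(* The relation between [p] and [q] gives the exponent [n + m * alpha + beta]; the kernel bound
   absorbs [beta]. *)
have -> : l `^ (n%:R * (1 + (p^-1 - q^-1))) =
   l `^ (n%:R + m%:R * alpha) * l `^ n%:R / l `^ (n%:R - beta).
  rewrite !powR_expR// -expRN -!expRD; congr expR; rewrite -!mulrDl -mulNr -mulrDl.
  congr (_ * _); rewrite hpq; field.
  by rewrite !gt_eqF// (lt_trans ltr01 p1).
have z1 : l `^ n%:R != 0 by rewrite gt_eqF// powR_gt0.
have z2 : l `^ (n%:R - beta) != 0 by rewrite gt_eqF// powR_gt0.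
by field; rewrite ?z1 ?z2 ?gt_eqF.
Qed.

End assembly.

(** * Mean oscillation *)

Section oscillation.
Context d (T : measurableType d) (R : realType) (mu : {measure set T -> \bar R}).
Variable u : T -> R.
Hypothesis mu_ : measurable_fun setT u.

(** Where [t = |u x - c|] is at most [s], the first term suffices; where it exceeds [s], [t ^+ m] is
    at least [s ^+ m.-1 * t]. *)
Lemma oscillation_split (c s : R) m (Q E1 E2 : set T) : (0 < m)%N -> 0 < s ->
  measurable Q -> measurable E1 -> measurable E2 -> Q `<=` E1 `|` E2 ->
  (\int[mu]_(x in Q) `|u x - c|%:E <=
   s%:E * mu Q + ((s ^+ m.-1)^-1)%:E *
     (\int[mu]_(x in E1) (`|u x - c| ^+ m)%:E + \int[mu]_(x in E2) (`|u x - c| ^+ m)%:E))%E.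
Proof.
move=> m0 s0 mQ mE1 mE2 QE.
have si0 : 0 <= (s ^+ m.-1)^-1 by rewrite invr_ge0 exprn_ge0// ltW.
have I0 E : (0 <= \int[mu]_(x in E) (`|u x - c| ^+ m)%:E)%E.
  by apply: integral_ge0 => x _; rewrite lee_fin exprn_ge0.
rewrite ge0_muleDr//.
(* The four integrals take the common form of a constant times [|u - c|] to the power 1, 0 or [m] on
   a set, so that the comparison becomes pointwise. *)
have -> : (\int[mu]_(x in Q) `|u x - c|%:E =
    \int[mu]_x (1 * (`|u x - c| ^+ 1 * \1_Q x))%:E)%E.
  by rewrite (integral_osc_indic mu_ mu c 1 ler01 mQ) mul1e.
have -> : (s%:E * mu Q = \int[mu]_x (s * (`|u x - c| ^+ 0 * \1_Q x))%:E)%E.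
  rewrite (integral_osc_indic mu_ mu c 0 (ltW s0) mQ); congr (_ * _)%E.
  by under eq_integral do rewrite expr0; rewrite integral_cst// mul1e.
rewrite -(integral_osc_indic mu_ mu c m si0 mE1) -(integral_osc_indic mu_ mu c m si0 mE2).
have pos (k : R) j (E : set T) x : 0 <= k -> 0 <= k * (`|u x - c| ^+ j * \1_E x).
  by move=> k0; rewrite mulr_ge0// mulr_ge0// exprn_ge0.
have mea (k : R) j (E : set T) : measurable E ->
    measurable_fun setT (fun x => (k * (`|u x - c| ^+ j * \1_E x))%:E).
  by move=> mE; apply/measurable_EFinP; exact: measurable_osc_indic.
rewrite -ge0_integralD//; last 4 first.
- by move=> x _; rewrite lee_fin pos.
- exact: mea.
- by move=> x _; rewrite lee_fin pos.
- exact: mea.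
rewrite -ge0_integralD//; last 4 first.
- by move=> x _; rewrite lee_fin pos// ltW.
- exact: mea.
- by move=> x _; rewrite adde_ge0// lee_fin pos.
- by apply: emeasurable_funD; exact: mea.
apply: ge0_le_integral_nonmeasurable => x _; first by rewrite lee_fin pos.
rewrite -!EFinD lee_fin.
have [Qx|nQ] := pselect (Q x); last first.
  rewrite [\1_Q x]indicE memNset// !mulr0 add0r addr_ge0// pos//.
rewrite [\1_Q x]indicE mem_set// !mulr1 mul1r expr1 ?expr0.
set t := `|u x - c|; have t0 : 0 <= t by exact: normr_ge0.
have key : t <= s + (s ^+ m.-1)^-1 * t ^+ m.
  have [ts|/ltW st] := leP t s.
    by rewrite (le_trans ts)// lerDl mulr_ge0// exprn_ge0.
  rewrite (@le_trans _ _ ((s ^+ m.-1)^-1 * t ^+ m))// ?lerDr ?(ltW s0)//.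
  rewrite mulrC ler_pdivlMr ?exprn_gt0// -{2}(prednK m0) exprS.
  by apply: ler_wpM2l => //; apply: lerXn2r; rewrite ?nnegrE// ltW.
apply: (le_trans key); rewrite lerD2l.
have A0 : 0 <= (s ^+ m.-1)^-1 * t ^+ m by rewrite mulr_ge0// exprn_ge0.
have [Ex|Ex] := QE _ Qx.
  by rewrite [\1_E1 x]indicE mem_set// mulr1 lerDl pos.
by rewrite [\1_E2 x]indicE mem_set// mulr1 lerDr pos.
Qed.

(** The mean differs from [c] by at most the average of [|u - c|]; integrating this over [Q]
    accounts for the factor 2. *)
Lemma mean_oscillation_le (c V : R) (Q : set T) : 0 < V -> measurable Q ->
  mu Q = V%:E -> mu.-integrable Q (EFin \o u) ->
  (\int[mu]_(x in Q) `|u x - V^-1 * \int[mu]_(y in Q) u y|%:E <=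
   2%:E * \int[mu]_(x in Q) `|u x - c|%:E)%E.
Proof.
move=> V0 mQ QV iu.
set A := V^-1 * _.
have muQ : measurable_fun Q u by exact: measurable_funTS.
have mosc c' : measurable_fun Q (fun x => `|u x - c'|).
  by apply: measurableT_comp => //; apply: measurable_funB.
have ic c' : mu.-integrable Q (EFin \o cst c').
  apply/integrableP; split; first exact/measurable_EFinP.
  rewrite (eq_integral (cst `|c'|%:E))// integral_cst// QV -EFinM.
  by rewrite ltry.
have iuc : mu.-integrable Q (EFin \o (fun x => u x - c)).
  have := integrableB mQ iu (ic c).
  by apply: eq_integrable => // x _; rewrite /= EFinB.
have iauc : mu.-integrable Q (EFin \o (fun x => `|u x - c|)).
  exact: integrable_abse iuc.
pose r := \int[mu]_(x in Q) `|u x - c|.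
have rE : (\int[mu]_(x in Q) `|u x - c|%:E)%E = r%:E.
  by rewrite /r /Rintegral fineK//; exact: integrable_fin_num.
have Ac : `|c - A| <= V^-1 * r.
  have -> : c - A = - (V^-1 * \int[mu]_(x in Q) (u x - c)).
    rewrite (RintegralB mQ iu (ic c)) Rintegral_cst// QV /= /A.
    by field; rewrite gt_eqF.
  rewrite normrN normrM gtr0_norm ?invr_gt0// ler_pM2l ?invr_gt0//.
  exact: le_normr_Rintegral.
apply: (@le_trans _ _ (\int[mu]_(x in Q) (`|u x - c|%:E + `|c - A|%:E))%E).
  apply: ge0_le_integral => //.
  - by apply/measurable_EFinP.
  - by apply: emeasurable_funD => //; apply/measurable_EFinP.
  - move=> x _; rewrite -EFinD lee_fin.
    by rewrite (_ : u x - A = (u x - c) + (c - A)) ?ler_normD// addrA subrK.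
rewrite ge0_integralD//; last by apply/measurable_EFinP.
rewrite integral_cst// QV rE -!EFinM -EFinD lee_fin.
have : `|c - A| * V <= r.
  by rewrite -ler_pdivlMr// mulrC.
by rewrite mulrDl mul1r lerD2l.
Qed.

End oscillation.

(** * From the real and imaginary parts of [b] to [BMO_alpha] *)

Section conclusion.
Context (R : realType) (n : nat).
Local Notation lambda := (lebesgue R n).

Lemma part_oscillation (m : nat) (p q alpha beta : R)
    (w Omega u : 'rV[R]_n -> R) (b : 'rV[R]_n -> R[i]) (c : bool) :
  (0 < n)%N -> (0 < m)%N -> 1 < p -> 1 < q -> 0 < alpha -> 0 <= beta < n%:R ->
  q^-1 = p^-1 - (m%:R * alpha + beta) / n%:R ->
  Apq p q w ->
  measurable_fun (sphere R n : set (rvS R n)) Omega ->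
  (exists U : set 'rV[R]_n, [/\ open U,
      {ae surface R n, forall t, (sphere R n `&` U) t -> 0 <= Omega t} \/
      {ae surface R n, forall t, (sphere R n `&` U) t -> Omega t <= 0} &
      ~ {ae surface R n, forall t, (sphere R n `&` U) t -> Omega t = 0}]) ->
  (exists2 C : R, 0 < C & forall E : set 'rV[R]_n,
      bounded_set E -> measurable (E : set (rvL R n)) ->
      {ae lambda, forall x, iter_comm_defined Omega beta b m (cindic E) x} /\
      (wLnorm q w (iter_comm Omega beta b m (cindic E))
        <= C%:E * wpow_measure p w E `^ p^-1)%E) ->
  measurable_fun (setT : set (rvL R n)) u ->
  (forall x y, cpart c ((b x - b y) ^+ m) = (u x - u y) ^+ m) ->
  exists2 C' : R, 0 <= C' & forall (a : 'rV[R]_n) l, 0 < l -> exists c0 : R,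
    (\int[lambda]_(x in cube a l) `|u x - c0|%:E <= (C' * l `^ (n%:R + alpha))%:E)%E.
Proof.
move=> n0 m0 p1 q1 al0 /andP[be0 ben] hpq [ww Ach] mO sO [C C0 hT] mu_ bu.
have n0' : 0 < n%:R :> R by rewrite ltr0n.
have m0' : 0 < m%:R :> R by rewrite ltr0n.
(* Strict because [m * alpha + beta > 0]. *)
have pq : p < q.
  rewrite -ltf_pV2 ?posrE ?(lt_trans ltr01)// hpq ltrBlDr ltrDl.
  by rewrite divr_gt0// ltr_pwDl// mulr_gt0.
have [W W0 {}Ach] : exists2 W, 0 <= W &
    forall Q, is_cube Q -> (Apq_char p q w Q <= W%:E)%E.
  move: Ach; set S := ereal_sup _ => Soo; exists (Num.max 0 (fine S)).
    by rewrite le_max lexx.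
  move=> Q hQ; have : (Apq_char p q w Q <= S)%E.
    by apply: ereal_sup_ubound; exists Q.
  move=> /le_trans; apply; move: Soo; case: S => [r _|//|_]; last by rewrite leNye.
  by rewrite lee_fin le_max lexx orbT.
have [tau [kappa [M [tau1 k0 M0 HK]]]] := signed_kernel_lower_bound n0 ben mO sO.
have [C1 C10 H1] := one_sided_oscillation n0 p1 q1 pq hpq ww Ach W0 C0 k0 M0 tau1 hT mu_ bu.
exists (1 + 2 * C1); first by rewrite addr_ge0// mulr_ge0.
move=> a l l0; have [a' [aa' [e e0 eP] HG]] := HK a l l0.
have mP : measurable (cube a' l : set (rvL R n)) by exact: lebesgue_measurable_cube.
have mQ : measurable (cube a l : set (rvL R n)) by exact: lebesgue_measurable_cube.
have lP : lambda (cube a' l) = (l ^+ n)%:E by rewrite lebesgue_cube// ltW.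
have lQ : lambda (cube a l) = (l ^+ n)%:E by rewrite lebesgue_cube// ltW.
have Poo : (lambda (cube a' l) < +oo)%E by rewrite lP ltry.
have [c0 [med1 med2]] := ex_median mP Poo (measurable_funTS mu_).
have lP2 : ((2^-1)%:E * lambda (cube a' l) = (2^-1 * l ^+ n)%:E)%E by rewrite lP.
have hF1 : ((2^-1 * l ^+ n)%:E <=
    lambda (cube a' l `&` [set y | (0 <= 1 * (c0 - u y))%R]))%E.
  rewrite -lP2; apply: (le_trans med2); rewrite le_eqVlt; apply/orP; left; apply/eqP; congr (lambda _).
  by apply/seteqP; split => y /= [Py]; rewrite mul1r subr_ge0.
have hF2 : ((2^-1 * l ^+ n)%:E <=
    lambda (cube a' l `&` [set y | (0 <= -1 * (c0 - u y))%R]))%E.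
  rewrite -lP2; apply: (le_trans med1); rewrite le_eqVlt; apply/orP; left; apply/eqP; congr (lambda _).
  by apply/seteqP; split => y /= [Py]; rewrite mulN1r oppr_ge0 subr_le0.
(* Both halves of [Q] use the same cube [P] and the same median. *)
have B1 := H1 a a' l e c0 1 l0 e0 aa' eP HG (or_introl erefl) hF1.
have B2 := H1 a a' l e c0 (-1) l0 e0 aa' eP HG (or_intror erefl) hF2.
(* This [s] balances the two terms: [s] times the volume of [Q], and [l] to the power
   [n + m * alpha] divided by [s ^+ m.-1], both equal [l] to the power [n + alpha]. *)
exists c0; pose s := l `^ alpha.
have s0 : 0 < s by rewrite powR_gt0.
set E1 := _ `&` _ in B1; set E2 := _ `&` _ in B2.
have mE1 : measurable (E1 : set (rvL R n)).
  by apply: measurableI => //; exact: measurable_upper_half.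
have mE2 : measurable (E2 : set (rvL R n)).
  by apply: measurableI => //; exact: measurable_upper_half.
have QE : cube a l `<=` E1 `|` E2.
  move=> x Qx; have [h|/ltW h] := leP 0 (u x - c0).
    by left; split => //=; rewrite mul1r.
  by right; split => //=; rewrite mulN1r oppr_ge0.
apply: (@le_trans _ _ (s%:E * lambda (cube a l) + ((s ^+ m.-1)^-1)%:E *
    (\int[lambda]_(x in E1) (`|u x - c0| ^+ m)%:E +
     \int[lambda]_(x in E2) (`|u x - c0| ^+ m)%:E))%E).
  exact: (oscillation_split lambda mu_ c0 m0 s0 mQ mE1 mE2 QE).
rewrite lQ.
have si0 : 0 <= (s ^+ m.-1)^-1 by rewrite invr_ge0 exprn_ge0// ltW.
apply: (le_trans (leeD2l _ (lee_wpmul2l _ (leeD B1 B2)))); first by rewrite lee_fin.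
have eE (x1 x2 x3 x4 : R) : (x1%:E * x2%:E + x3%:E * (x4%:E + x4%:E) =
    (x1 * x2 + x3 * (x4 + x4))%:E)%E by [].
rewrite eE lee_fin.
have E : (s ^+ m.-1)^-1 * l `^ (n%:R + m%:R * alpha) = l `^ (n%:R + alpha).
  rewrite -(powR_mulrn _ (ltW s0)) /s -powRrM !powR_expR// -expRN -expRD; congr expR.
  by rewrite -{2}(prednK m0) [in X in (_ + X * _)](_ : m.-1.+1%:R = m.-1%:R + 1) ?natr1//; ring.
have E' : s * l ^+ n = l `^ (n%:R + alpha).
  rewrite -powR_mulrn ?(ltW l0)// /s !powR_expR// -expRD; congr expR; ring.
have rE (k L : R) : k * (C1 * L + C1 * L) = 2 * C1 * (k * L) by ring.
by rewrite rE E E' -[X in X + _ <= _]mul1r -mulrDl.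
Qed.

(** Taking the real part is additive, which settles [m = 1]; it commutes with higher powers because
    [b] is then real-valued. *)
Lemma cpart_re_pow (m : nat) (b : 'rV[R]_n -> R[i]) x y :
  ((2 <= m)%N -> forall z, complex.Im (b z) = 0) ->
  cpart true ((b x - b y) ^+ m) = (complex.Re (b x) - complex.Re (b y)) ^+ m.
Proof.
case: m => [|[|m]] b_real; first by rewrite !expr0.
  by rewrite !expr1; case: (b x) => r s; case: (b y).
have bE z : b z = (complex.Re (b z))%:C%C.
  by have := b_real isT z; case: (b z) => r s /= ->.
by rewrite {1}[b x]bE {1}[b y]bE -rmorphB -rmorphXn.
Qed.

Lemma normc_le_parts (z : R[i]) : Normc.normc z <= `|cpart true z| + `|cpart false z|.
Proof.
case: z => r s /=.
rewrite -[leRHS]ger0_norm ?addr_ge0// -sqrtr_sqr; apply: ler_wsqrtr.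
rewrite sqrrD -!normrX !(ger0_norm (sqr_ge0 _)) -addrA lerD2l lerDr.
by rewrite mulrn_wge0// mulr_ge0.
Qed.

Lemma cpart_caverage c (b : 'rV[R]_n -> R[i]) (z : R[i]) Q :
  cpart c (z - caverage b Q) =
  cpart c z - (vol Q)^-1 * \int[lambda]_(y in Q) cpart c (b y).
Proof.
by rewrite /caverage /cintegral; case: z => r s; case: c => /=;
  rewrite mul0r ?subr0 ?addr0.
Qed.

Lemma loc_integrable_cube (u : 'rV[R]_n -> R) (a : 'rV[R]_n) l :
  loc_integrable u -> lambda.-integrable (cube a l) (EFin \o u).
Proof.
move=> [mu_ iu]; apply/integrableP; split; last exact: (iu _ (@compact_cube R n a l)).
by apply/measurable_EFinP; exact: measurable_funTS.
Qed.

(** Each part costs a factor 2 for exchanging the free constant with the mean, and the modulus is at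
    most the sum of the two parts. *)
Lemma BMO_of_parts (alpha Cu Cv : R) (b : 'rV[R]_n -> R[i]) : (0 < n)%N ->
  cloc_integrable b ->
  (forall (a : 'rV[R]_n) l, 0 < l -> exists c0 : R, (\int[lambda]_(x in cube a l)
    `|complex.Re (b x) - c0|%:E <= (Cu * l `^ (n%:R + alpha))%:E)%E) ->
  (forall (a : 'rV[R]_n) l, 0 < l -> exists c0 : R, (\int[lambda]_(x in cube a l)
    `|complex.Im (b x) - c0|%:E <= (Cv * l `^ (n%:R + alpha))%:E)%E) ->
  BMO alpha b.
Proof.
move=> n0 hb Hu Hv; split=> //; have n0' : 0 < n%:R :> R by rewrite ltr0n.
apply: (@le_lt_trans _ _ (2 * (Cu + Cv))%:E); last by rewrite ltry.
apply: ge_ereal_sup => _ [_ [a [l l0 ->]] <-].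
set Q := cube a l.
have mQ : measurable (Q : set (rvL R n)) by exact: lebesgue_measurable_cube.
have V0 : 0 < l ^+ n by rewrite exprn_gt0.
have lQ : lambda Q = (l ^+ n)%:E by rewrite lebesgue_cube// ltW.
have vQ : vol Q = l ^+ n by rewrite vol_cube// ltW.
have part c C0 : loc_integrable (fun x => cpart c (b x)) ->
    (exists c0 : R, (\int[lambda]_(x in Q) `|cpart c (b x) - c0|%:E <=
       (C0 * l `^ (n%:R + alpha))%:E)%E) ->
    (\int[lambda]_(x in Q) `|cpart c (b x - caverage b Q)|%:E <=
     (2 * (C0 * l `^ (n%:R + alpha)))%:E)%E.
  move=> lu [c0 H].
  have := mean_oscillation_le lu.1 c0 V0 mQ lQ (loc_integrable_cube a l lu).
  move=> h; rewrite EFinM; apply: (le_trans _ (lee_wpmul2l _ H)); last by rewrite lee_fin.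
  apply: le_trans h; rewrite le_eqVlt; apply/orP; left; apply/eqP.
  by apply: eq_integral => x _; rewrite cpart_caverage vQ.
have Pu := part true Cu hb.1 (Hu a l l0).
have Pv := part false Cv hb.2 (Hv a l l0).
rewrite /mean_osc vQ.
have -> : (l ^+ n) `^ (1 + alpha / n%:R) = l `^ (n%:R + alpha).
  by rewrite -powR_mulrn ?(ltW l0)// -powRrM; congr (_ `^ _); field; rewrite gt_eqF.
set B := l `^ _ in Pu Pv *; have B0 : 0 < B by rewrite powR_gt0.
rewrite lee_pdivrMl//.
apply: (@le_trans _ _ (\int[lambda]_(x in Q) (`|cpart true (b x - caverage b Q)|%:E +
    `|cpart false (b x - caverage b Q)|%:E))%E).
  apply: ge0_le_integral_nonmeasurable => x _; rewrite ?lee_fin; first by case: (b x - _) => r s; exact: sqrtr_ge0.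
  exact: normc_le_parts.
have mpart c : loc_integrable (fun x => cpart c (b x)) ->
    measurable_fun (Q : set (rvL R n)) (fun x => `|cpart c (b x - caverage b Q)|%:E).
  move=> lu; apply/measurable_EFinP.
  have H := @measurable_oscX _ (rvL R n) R _ lu.1
    ((vol Q)^-1 * \int[lambda]_(y in Q) cpart c (b y)) 1.
  have {}H : measurable_fun (Q : set (rvL R n)) _ := measurable_funTS H.
  apply: eq_measurable_fun H => x _.
  by rewrite cpart_caverage expr1.
rewrite ge0_integralD//; [|exact: (mpart true hb.1)|exact: (mpart false hb.2)].
apply: (le_trans (leeD Pu Pv)); rewrite -EFinD -EFinM lee_fin.
by rewrite le_eqVlt; apply/orP; left; apply/eqP; ring.
Qed.

End conclusion.

Unset Implicit Arguments.
Set Strict Implicit.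

Theorem theorem1p4 (R : realType) (n m : nat) (p q alpha beta : R)
    (w : 'rV[R]_n -> R) (Omega : 'rV[R]_n -> R) (b : 'rV[R]_n -> R[i])
    (hp : 1 < p) (hq : 1 < q)
    (halpha : 0 < alpha <= 1) (hbeta : 0 <= beta < n%:R)
    (hab : alpha + beta < n%:R) (hm : (0 < m)%N)
    (hpq : q^-1 = p^-1 - (m%:R * alpha + beta) / n%:R)
    (hw : Apq p q w)
    (mOmega : measurable_fun (sphere R n : set (rvS R n)) Omega)
    (Omega_mean0 : beta = 0 ->
      (\int[surface R n]_(t in sphere R n) (Omega t)%:E = 0)%E)
    (Omega_sign : exists U : set 'rV[R]_n, [/\ open U,
      {ae surface R n, forall t, (sphere R n `&` U) t -> 0 <= Omega t} \/
      {ae surface R n, forall t, (sphere R n `&` U) t -> Omega t <= 0} &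
      ~ {ae surface R n, forall t, (sphere R n `&` U) t -> Omega t = 0}])
    (hb : cloc_integrable b)
    (b_real : (2 <= m)%N -> forall x, complex.Im (b x) = 0)
    (hT : exists2 C : R, 0 < C & forall E : set 'rV[R]_n,
      bounded_set E -> measurable (E : set (rvL R n)) ->
      {ae lebesgue R n, forall x, iter_comm_defined Omega beta b m (cindic E) x} /\
      (wLnorm q w (iter_comm Omega beta b m (cindic E))
        <= C%:E * wpow_measure p w E `^ p^-1)%E) :
  BMO alpha b.
Proof.
(* In dimension 0, [alpha + beta < n] would contradict [alpha > 0] and [beta >= 0]. *)
have n0 : (0 < n)%N.
  case: (posnP n) => // n0; have /andP[a0 _] := halpha; have /andP[b0 _] := hbeta.
  by move: hab; rewrite n0 ltNge addr_ge0// ltW.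
have /andP[al0 _] := halpha.
have re_pow x y := @cpart_re_pow R n m b x y b_real.
have [Cu _ Hu] := part_oscillation n0 hm hp hq al0 hbeta hpq hw mOmega Omega_sign
  hT hb.1.1 re_pow.
have [Cv Hv] : exists Cv : R, forall (a : 'rV[R]_n) l, 0 < l -> exists c0 : R,
    (\int[lebesgue R n]_(x in cube a l) `|complex.Im (b x) - c0|%:E <=
      (Cv * l `^ (n%:R + alpha))%:E)%E.
  (* For [m >= 2] the imaginary part vanishes; for [m = 1] the difference [b x - b y] enters
     linearly and the imaginary part is treated like the real one. *)
  have [m2|m1] := leqP 2 m.
    exists 0 => a l l0; exists 0; rewrite mul0r.
    by under eq_integral do rewrite b_real// subr0 normr0; rewrite integral0.
  have m1E : m = 1%N by apply/eqP; rewrite eqn_leq -ltnS m1.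
  have im_pow x y : cpart false ((b x - b y) ^+ m) =
      (complex.Im (b x) - complex.Im (b y)) ^+ m.
    by rewrite m1E !expr1; case: (b x) => r s; case: (b y).
  have [Cv _ Hv] := part_oscillation n0 hm hp hq al0 hbeta hpq hw mOmega Omega_sign
    hT hb.2.1 im_pow.
  by exists Cv.
exact: BMO_of_parts n0 hb Hu Hv.
Qed.
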